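(* (Single traversing constraints) For a single-block warehouse, no optimal solution (of the joint order batching and picker routing problem described in the context) will be cut off by the following constraints: $$\alpha_{tv}+\beta_{tv}\le1\qquad\text{for all }t\in\mathcal T,\ o\in O,\ v\in L_o.$$
   Context: **Warehouse graph.** A rectangular warehouse has vertical picking aisles crossed by horizontal cross-aisles. The part between two adjacent cross-aisles is a block, and the section of a picking aisle inside a block is a subaisle; a single-block warehouse has exactly one block. Subaisles are indexed by $[W_{sub}]=\{1,\dots,W_{sub}\}$. $V_I$ is the set of artificial locations (the endpoints of subaisles). $V_L$ is the set of picking locations, each lying on a subaisle. $V=V_I\cup V_L$. The origin $s\in V_I$ is the top-left artificial location. $\tilde E$ consists of both directed arcs $(u,v),(v,u)$ for every pair of neighboring locations within a picking aisle and every pair of neighboring artificial locations within a cross-aisle; $d_{uv}$ is the direct distance between $u$ and $v$. For a subaisle $i$: $V_{sub}(i)$ is its set of picking locations, $f(i)$ its northern and $l(i)$ its southern artificial location. For a picking location $v$ in subaisle $i$, $n(v)$ and $s(v)$ denote the adjacent northern and southern location; similarly $s(f(i))$ is the location of the subaisle adjacent to $f(i)$ on its south and $n(l(i))$ the one adjacent to $l(i)$ on its north. For $S\subset V$, $\delta^+(S)$ / $\delta^-(S)$ are the arcs of $\tilde E$ leaving / entering $S$; $\delta^\pm(v)=\delta^\pm(\{v\})$. **Orders and pickers.** $O$ is a set of orders; order $o$ has size $b_o$ and set of picking locations $L_o$. Each picker has capacity $B$. $\mathcal T=\{1,\dots,T\}$ is the set of pickers, where $T$ is the number of pickers necessary to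 carry all products (obtained by solving a bin-packing problem). **The problem.** The joint order batching and picker routing problem assigns every order to exactly one picker, respecting capacities, and gives every picker $t$ a closed walk from the origin visiting all picking locations of its orders, so as to minimize the total distance. Its basic formulation is: minimize $\sum_{t\in\mathcal T}\sum_{(u,v)\in\tilde E}d_{uv}x_{tuv}$ over binary $x_{tuv}$ (picker $t$ traverses arc $(u,v)\in\tilde E$), $y_{tv}$ (picker $t$ visits $v\in V$), $z_{ot}$ (picker $t$ picks order $o$), subject to, for all $t\in\mathcal T$, $o\in O$: $\sum_{(s,v)\in\delta^+(s)}x_{tsv}\ge1$; $\sum_{(u,v)\in\delta^+(u)}x_{tuv}\ge z_{ot}$ for $u\in L_o$; $y_{tu}\ge x_{tuv}$ for $u\in V\setminus\{s\}$, $(u,v)\in\delta^+(u)$; $\sum_{(u,v)\in\delta^+(S)}x_{tuv}\ge y_{tu_0}$ for $S\subset V\setminus\{s\}$, $|S|\ge2$, $u_0\in S$; $\sum_{(v,u)\in\delta^+(v)}x_{tvu}=\sum_{(u,v)\in\delta^-(v)}x_{tuv}$ for $v\in V$; $\sum_{t\in\mathcal T}z_{ot}=1$; $\sum_{o\in O}b_oz_{ot}\le B$. **Subaisle cuts and the variables $\alpha,\beta$.** The formulation is augmented by auxiliary binary variables $\alpha_{tv},\beta_{tv}$ ($t\in\mathcal T$, $i\in[W_{sub}]$, $v\in V_{sub}(i)$) and the following constraints, for all $t\in\mathcal T$, $i\in[W_{sub}]$: $\alpha_{tv}\ge\alpha_{t,s(v)}$ for $v\in V_{sub}(i)\setminus\{n(l(i))\}$;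 $x_{t,n(v),v}\ge\alpha_{tv}$ for $v\in V_{sub}(i)$; $\beta_{tv}\ge\beta_{t,n(v)}$ for $v\in V_{sub}(i)\setminus\{s(f(i))\}$; $x_{t,s(v),v}\ge\beta_{tv}$ for $v\in V_{sub}(i)$; and $\alpha_{tv}+\beta_{tv}\ge z_{ot}$ for all $o\in O$, $v\in L_o$. Thus $\alpha_{tv}=1$ (resp. $\beta_{tv}=1$) implies that the walk of picker $t$ contains a straight path connecting the northern (resp. southern) artificial location of the subaisle and $v$. *)

(* Defs.v *)
From mathcomp Require Import all_boot all_order all_algebra.

Set Implicit Arguments.
Unset Strict Implicit.
Unset Printing Implicit Defensive.

Import Order.TTheory GRing.Theory Num.Theory.
Local Open Scope ring_scope.

(* A rectangular warehouse with m.+1 picking aisles and k blocks, hence k.+1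
   cross-aisles.  Aisles are numbered from left to right, cross-aisles, blocks
   and the picking locations of a subaisle from north to south; the subaisle of
   aisle a in block j is the pair (a, j).  Abscissas grow to the right and
   ordinates grow to the south.  A subaisle may contain no picking location. *)
Record warehouse (R : realFieldType) (m k : nat) := Warehouse {
  nloc : 'I_m.+1 * 'I_k -> nat;
  aisle_x : 'I_m.+1 -> R;
  cross_y : 'I_k.+1 -> R;
  loc_y : forall i, 'I_(nloc i) -> R;
  aisle_x_lt : forall a a' : 'I_m.+1, (a < a')%N -> aisle_x a < aisle_x a';
  cross_y_lt : forall c c' : 'I_k.+1, (c < c')%N -> cross_y c < cross_y c';
  loc_y_lt : forall i (p q : 'I_(nloc i)), (p < q)%N -> loc_y p < loc_y q;
  loc_y_bounds : forall i (p : 'I_(nloc i)),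
    cross_y (widen_ord (leqnSn k) i.2) < loc_y p < cross_y (lift ord0 i.2)
}.

Definition subaisle m k : Type := ('I_m.+1 * 'I_k)%type.

(* V_I, V_L and V = V_I + V_L *)
Definition artificial m k : Type := ('I_m.+1 * 'I_k.+1)%type.
Definition picking R m k (W : warehouse R m k) : Type :=
  {i : 'I_m.+1 * 'I_k & 'I_(nloc W i)}.
Definition location R m k (W : warehouse R m k) : Type :=
  (artificial m k + picking W)%type.

Definition origin R m k (W : warehouse R m k) : location W := inl (ord0, ord0).

(* f(i) and l(i) *)
Definition first_loc R m k (W : warehouse R m k) (i : subaisle m k) :
  location W := inl (i.1, widen_ord (leqnSn k) i.2).
Definition last_loc R m k (W : warehouse R m k) (i : subaisle m k) :
  location W := inl (i.1, lift ord0 i.2).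

(* The p-th location of subaisle i from the north: f(i) for p = 0, the picking
   locations for 1 <= p <= nloc i, and l(i) for p = nloc i + 1. *)
Definition loc_at R m k (W : warehouse R m k) (i : subaisle m k) (p : nat) :
  location W :=
  if p is q.+1 then
    if insub q is Some r then inr (Tagged (fun j => 'I_(nloc W j)) (r : 'I_(nloc W i)))
    else last_loc W i
  else first_loc W i.

(* n(v) and s(v) *)
Definition north R m k (W : warehouse R m k) (v : picking W) : location W :=
  loc_at W (tag v) (tagged v).
Definition south R m k (W : warehouse R m k) (v : picking W) : location W :=
  loc_at W (tag v) (tagged v).+2.

Definition aisle_step R m k (W : warehouse R m k) (u v : location W) : bool :=
  [exists i : subaisle m k, [exists p : 'I_(nloc W i).+1,
     (u == loc_at W i p) && (v == loc_at W i p.+1)]].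

Definition cross_step R m k (W : warehouse R m k) (u v : location W) : bool :=
  match u, v with
  | inl (a, c), inl (a', c') => (c == c') && (a.+1 == a' :> nat)
  | _, _ => false
  end.

(* (u, v) is an element of the symmetric arc set E~ *)
Definition adjacent R m k (W : warehouse R m k) (u v : location W) : bool :=
  [|| aisle_step u v, aisle_step v u, cross_step u v | cross_step v u].

Definition abscissa R m k (W : warehouse R m k) (u : location W) : R :=
  match u with
  | inl (a, _) => aisle_x W a
  | inr v => aisle_x W (tag v).1
  end.
Definition ordinate R m k (W : warehouse R m k) (u : location W) : R :=
  match u with
  | inl (_, c) => cross_y W c
  | inr v => loc_y (tagged v)
  end.

(* The endpoints of an arc share a coordinate, so on arcs this is the
   straight-line distance. *)
Definition dist R m k (W : warehouse R m k) (u v : location W) : R :=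
  `|abscissa u - abscissa v| + `|ordinate u - ordinate v|.

Definition arcs_out R m k (W : warehouse R m k) (S : {set location W}) :
  {set location W * location W} :=
  [set e | [&& adjacent e.1 e.2, e.1 \in S & e.2 \notin S]].
Definition arcs_in R m k (W : warehouse R m k) (S : {set location W}) :
  {set location W * location W} :=
  [set e | [&& adjacent e.1 e.2, e.1 \notin S & e.2 \in S]].

(* n pickers of capacity B can carry all orders. *)
Definition packable (R : realFieldType) (O : finType) (b : O -> R) (B : R)
    (n : nat) : Prop :=
  exists f : O -> 'I_n, forall t, \sum_(o | f o == t) b o <= B.

Definition bin_packing_number (R : realFieldType) (O : finType) (b : O -> R)
    (B : R) (T : nat) : Prop :=
  packable b B T /\ forall n, packable b B n -> (T <= n)%N.

(* The values of x t u v for (u, v) outside E~ occur neither in the constraints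
   nor in the objective. *)
Record basic_feasible R m k (W : warehouse R m k) (O : finType)
    (L : O -> {set picking W}) (b : O -> R) (B : R) (T : nat)
    (x : 'I_T -> location W -> location W -> bool)
    (y : 'I_T -> location W -> bool) (z : O -> 'I_T -> bool) : Prop :=
  BasicFeasible {
  leave_origin : forall t,
    (1 <= \sum_(e in arcs_out [set origin W]) x t e.1 e.2)%N;
  visit_orders : forall t o (u : picking W), u \in L o ->
    (z o t <= \sum_(e in arcs_out [set inr u : location W]) x t e.1 e.2)%N;
  mark_visited : forall t u v, u != origin W ->
    (u, v) \in arcs_out [set u] -> (x t u v <= y t u)%N;
  connectivity : forall t (S : {set location W}) u0,
    S \subset ~: [set origin W] -> (2 <= #|S|)%N -> u0 \in S ->
    (y t u0 <= \sum_(e in arcs_out S) x t e.1 e.2)%N;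
  conservation : forall t v,
    (\sum_(e in arcs_out [set v]) x t e.1 e.2 =
     \sum_(e in arcs_in [set v]) x t e.1 e.2)%N;
  assign_once : forall o, (\sum_(t < T) z o t = 1)%N;
  respect_capacity : forall t, \sum_(o : O) b o * (z o t)%:R <= B
}.

Record subaisle_constraints R m k (W : warehouse R m k) (O : finType)
    (L : O -> {set picking W}) (T : nat)
    (x : 'I_T -> location W -> location W -> bool) (z : O -> 'I_T -> bool)
    (alpha beta : 'I_T -> picking W -> bool) : Prop :=
  SubaisleConstraints {
  (* south v is a picking location exactly when v is not n(l(i)) *)
  alpha_north : forall t (v w : picking W), south v = inr w ->
    (alpha t w <= alpha t v)%N;
  alpha_arc : forall t v, (alpha t v <= x t (north v) (inr v))%N;
  (* north v is a picking location exactly when v is not s(f(i)) *)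
  beta_south : forall t (v w : picking W), north v = inr w ->
    (beta t w <= beta t v)%N;
  beta_arc : forall t v, (beta t v <= x t (south v) (inr v))%N;
  alpha_beta_cover : forall t o v, v \in L o ->
    (z o t <= alpha t v + beta t v)%N
}.

Definition augmented_feasible R m k (W : warehouse R m k) (O : finType)
    (L : O -> {set picking W}) (b : O -> R) (B : R) (T : nat)
    (x : 'I_T -> location W -> location W -> bool)
    (y : 'I_T -> location W -> bool) (z : O -> 'I_T -> bool)
    (alpha beta : 'I_T -> picking W -> bool) : Prop :=
  basic_feasible L b B x y z /\ subaisle_constraints L x z alpha beta.

Definition total_distance R m k (W : warehouse R m k) (T : nat)
    (x : 'I_T -> location W -> location W -> bool) : R :=
  \sum_(t < T) \sum_(e : location W * location W | adjacent e.1 e.2)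
    dist e.1 e.2 * (x t e.1 e.2)%:R.

Definition basic_optimal R m k (W : warehouse R m k) (O : finType)
    (L : O -> {set picking W}) (b : O -> R) (B : R) (T : nat)
    (x : 'I_T -> location W -> location W -> bool)
    (y : 'I_T -> location W -> bool) (z : O -> 'I_T -> bool) : Prop :=
  basic_feasible L b B x y z /\
  forall x' y' z', @basic_feasible R m k W O L b B T x' y' z' ->
    total_distance x <= total_distance x'.

Definition augmented_optimal R m k (W : warehouse R m k) (O : finType)
    (L : O -> {set picking W}) (b : O -> R) (B : R) (T : nat)
    (x : 'I_T -> location W -> location W -> bool)
    (y : 'I_T -> location W -> bool) (z : O -> 'I_T -> bool)
    (alpha beta : 'I_T -> picking W -> bool) : Prop :=
  augmented_feasible L b B x y z alpha beta /\
  forall x' y' z' alpha' beta',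
    @augmented_feasible R m k W O L b B T x' y' z' alpha' beta' ->
    total_distance x <= total_distance x'.

Definition single_traversing R m k (W : warehouse R m k) (O : finType)
    (L : O -> {set picking W}) (T : nat)
    (alpha beta : 'I_T -> picking W -> bool) : Prop :=
  forall t o v, v \in L o -> (alpha t v + beta t v <= 1)%N.

(* Main.v *)
Require Import Defs.
From mathcomp Require Import all_boot all_order all_algebra.
From mathcomp Require Import zify ring lra.

(* If alpha and beta hold at the same location, flow conservation along the
   subaisle forces the picker to walk the whole subaisle in both directions.  In
   a single block such a doubled aisle [a] is never optimal.  If the cross-aisle
   gaps to the right of [a] carry a net flow, or if no other aisle is used, the
   southernmost edge of [a] is superfluous.  Otherwise let [c] be the nearest
   other aisle in use: all gaps between [a] and [c] have zero net flow, and each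
   of them is crossed at least twice.  Adding a circulation around the rectangle
   bounded by [a] and [c] makes [a] a single traversal and crosses each of these
   gaps once in the north and once in the south; aisle [c] becomes a single
   traversal, or, when it was one, a doubled aisle with one edge left out.  All
   visited locations are still visited and the length strictly decreases.
   Conversely the longest straight paths in any feasible solution satisfy the
   constraints on alpha and beta, because a visited location is entered from one
   of the two ends of its subaisle. *)

Set Implicit Arguments.
Unset Strict Implicit.
Unset Printing Implicit Defensive.

Import Order.TTheory GRing.Theory Num.Theory.
Local Open Scope ring_scope.

(** * Coordinates and arcs *)

Section Ladder.
Variables (R : realFieldType) (m : nat) (W : warehouse R m 1).
Implicit Types (u v : location W) (c p j : nat).

Definition column c : subaisle m 1 := (inord c, ord0).

Definition height c : nat := (nloc W (column c)).+1.

(* Column and row coordinates in the only block: [ladder c p] is the [p]-th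
   location of aisle [c] from the north, meaningful for [c <= m] and
   [p <= height c]. *)
Definition ladder c p : location W := loc_at W (column c) p.

Arguments ladder : simpl never.

(** [col] and [pos] invert [ladder]. With a single block there are only two cross-aisles, so an
    artificial location off the northern one ends its aisle in the south. *)
Definition col u : nat :=
  match u with inl (a, _) => a | inr v => (tag v).1 end.

Definition pos u : nat :=
  match u with
  | inl (a, r) => if r == ord0 then 0%N else height a
  | inr v => (tagged v).+1
  end.

Lemma column_val (i : subaisle m 1) : column i.1 = i.
Proof. by case: i => a r; rewrite /column /= inord_val (ord1 r). Qed.

Lemma ladder_val (i : subaisle m 1) p : loc_at W i p = ladder i.1 p.
Proof. by rewrite /ladder column_val. Qed.

Lemma col_ladder c p : (c <= m)%N -> col (ladder c p) = c.
Proof.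
move=> cm; rewrite /ladder /loc_at; case: p => [|p] /=; first by rewrite inordK.
by case: insubP => [q _ _|_] /=; rewrite inordK.
Qed.

Lemma pos_ladder c p : (p <= height c)%N -> pos (ladder c p) = p.
Proof.
rewrite /ladder /loc_at /height; case: p => [|p] //= ple.
case: insubP => [q _ /= -> //|] /=.
by rewrite /height /column inord_val -/(column c) => ?; lia.
Qed.

Lemma col_le u : (col u <= m)%N.
Proof. by case: u => [[a r]|v] /=; rewrite -ltnS ltn_ord. Qed.

Lemma pos_le u : (pos u <= height (col u))%N.
Proof.
case: u => [[a r]|[i q]] /=; first by case: ifP.
by rewrite /height column_val ltnS ltnW.
Qed.

Lemma ladderK u : ladder (col u) (pos u) = u.
Proof.
case: u => [[a r]|[i q]] /=.
  rewrite /ladder /loc_at /first_loc /last_loc /= inord_val.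
  case: eqP => [->|/eqP r0]; first by congr (inl (_, _)); apply: val_inj.
  rewrite /height insubN -?leqNgt //=; congr (inl (_, _)); apply: val_inj => /=.
  by case: r r0 => [[|[|]]].
rewrite -ladder_val /loc_at; case: insubP => [s _ /val_inj -> //|].
by rewrite ltn_ord.
Qed.

Lemma pos_pick (w : picking W) : (0 < pos (inr w) < height (col (inr w)))%N.
Proof. by case: w => i q; rewrite /= /height column_val ltnS. Qed.

Arguments col : simpl never.
Arguments pos : simpl never.

Lemma ladder_inj c c' p p' : (c <= m)%N -> (c' <= m)%N ->
  (p <= height c)%N -> (p' <= height c')%N ->
  ladder c p = ladder c' p' -> c = c' /\ p = p'.
Proof.
move=> cm cm' ph ph' e; split; first by rewrite -(col_ladder p cm) e col_ladder.
by rewrite -(pos_ladder ph) e pos_ladder.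
Qed.

Definition bottom c := ladder c (height c).

Lemma aisle_stepP u v :
  reflect (exists (i : 'I_m.+1) (p : 'I_(height i)),
             u = ladder i p /\ v = ladder i p.+1) (aisle_step u v).
Proof.
apply: (iffP existsP) => [[i /existsP[p /andP[/eqP-> /eqP->]]]|[i [p [-> ->]]]].
  have hi : (p < height i.1)%N by rewrite /height column_val.
  by exists i.1, (Ordinal hi); rewrite !ladder_val.
by exists (column i); apply/existsP; exists p; rewrite !eqxx.
Qed.

Lemma cross_stepP u v :
  reflect (exists j : 'I_m,
             (u = ladder j 0 /\ v = ladder j.+1 0) \/
             (u = bottom j /\ v = bottom j.+1)) (cross_step u v).
Proof.
have top0 (a : 'I_m.+1) : inl (a, ord0) = ladder a 0.
  by rewrite /ladder /= /first_loc /= inord_val; congr (inl (_, _)); apply: val_inj.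
have bot1 (a : 'I_m.+1) : inl (a, ord_max) = bottom a.
  rewrite -[LHS]ladderK /bottom /=; congr ladder.
apply: (iffP idP) => [|[j jP]]; last first.
  have jm : (j < m.+1)%N by rewrite ltnS ltnW.
  have jm1 : (j.+1 < m.+1)%N by rewrite ltnS.
  case: jP => [] [-> ->]; last first.
    rewrite /bottom /ladder /= !insubN -?leqNgt //=.
    by rewrite (inordK jm) (inordK jm1).
  by rewrite /ladder /= (inordK jm) (inordK jm1).
case: u => [[a r]|//]; case: v => [[a' r']|//] /= /andP[/eqP <- /eqP aa'].
have am : (a < m)%N by rewrite -ltnS aa'.
exists (Ordinal am) => /=; rewrite aa'.
have [->|->] : r = ord0 \/ r = ord_max.
  by case: r => [[|[|]] // ?]; [left|right]; apply: val_inj.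
  by left; rewrite !top0.
by right; rewrite !bot1.
Qed.

(** Each undirected edge is listed in one orientation only, southward or to the right, so case
    analyses on arcs have three cases up to symmetry. *)
Variant edge_spec u v : Prop :=
  | AisleEdge c p of (c <= m)%N & (p < height c)%N &
      u = ladder c p & v = ladder c p.+1
  | TopEdge j of (j < m)%N & u = ladder j 0 & v = ladder j.+1 0
  | BottomEdge j of (j < m)%N & u = bottom j & v = bottom j.+1.

Lemma adjacentP u v :
  reflect (edge_spec u v \/ edge_spec v u) (adjacent u v).
Proof.
apply: (iffP or4P) => [|[]].
- case=> [/aisle_stepP[i [p [-> ->]]]|/aisle_stepP[i [p [-> ->]]]|
          /cross_stepP[j [] [-> ->]]|/cross_stepP[j [] [-> ->]]].
  + by left; apply: (AisleEdge (leq_ord i) (ltn_ord p)).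
  + by right; apply: (AisleEdge (leq_ord i) (ltn_ord p)).
  + by left; apply: TopEdge.
  + by left; apply: BottomEdge.
  + by right; apply: TopEdge.
  + by right; apply: BottomEdge.
- case=> [c p cm ph -> ->|j jm -> ->|j jm -> ->].
  + apply: Or41; apply/aisle_stepP.
    by exists (Ordinal (cm : (c < m.+1)%N)), (Ordinal ph).
  + by apply: Or43; apply/cross_stepP; exists (Ordinal jm); left.
  + by apply: Or43; apply/cross_stepP; exists (Ordinal jm); right.
- case=> [c p cm ph -> ->|j jm -> ->|j jm -> ->].
  + apply: Or42; apply/aisle_stepP.
    by exists (Ordinal (cm : (c < m.+1)%N)), (Ordinal ph).
  + by apply: Or44; apply/cross_stepP; exists (Ordinal jm); left.
  + by apply: Or44; apply/cross_stepP; exists (Ordinal jm); right.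
Qed.

Lemma adjacentC u v : adjacent u v = adjacent v u.
Proof. by apply/adjacentP/adjacentP => -[]; [right|left|right|left]. Qed.

Lemma adjacent_irrefl u : ~~ adjacent u u.
Proof.
have E v w : edge_spec v w -> v != w.
  case=> [c p cm ph -> ->|j jm -> ->|j jm -> ->]; apply/eqP.
  - by case/ladder_inj=> //; [exact: ltnW | lia].
  - by case/ladder_inj=> //; [exact: ltnW | lia].
  - by case/ladder_inj=> //; [exact: ltnW | lia].
by apply/adjacentP => -[] /E; rewrite eqxx.
Qed.

(** * Sums over all arcs in ladder coordinates *)

Lemma sum_aisle (V : nmodType) (F : location W -> location W -> V) :
  \sum_(e : location W * location W | aisle_step e.1 e.2) F e.1 e.2 =
  \sum_(c < m.+1) \sum_(p < height c) F (ladder c p) (ladder c p.+1).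
Proof.
rewrite sig_big_dep /=.
pose h (k : {c : 'I_m.+1 & 'I_(height c)}) :=
  (ladder (tag k) (tagged k), ladder (tag k) (tagged k).+1).
transitivity (\sum_(e in h @: setT) F e.1 e.2).
  apply: eq_bigl => -[u v] /=; apply/aisle_stepP/imsetP => [[c [p [-> ->]]]|].
    by exists (Tagged (fun c : 'I_m.+1 => 'I_(height c)) p).
  by case=> -[c p] _ [-> ->]; exists c, p.
rewrite big_imset /=; first by apply: eq_bigl => k; rewrite inE.
move=> [c p] [c' p'] _ _ [] /ladder_inj [] //; try exact: leq_ord.
- exact: ltnW.
- exact: ltnW.
- by move=> /val_inj e; subst c' => /val_inj ->.
Qed.

Lemma sum_cross (V : nmodType) (F : location W -> location W -> V) :
  \sum_(e : location W * location W | cross_step e.1 e.2) F e.1 e.2 =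
  \sum_(j < m) (F (ladder j 0) (ladder j.+1 0) + F (bottom j) (bottom j.+1)).
Proof.
pose h (k : 'I_m * bool) :=
  if k.2 then (ladder k.1 0, ladder k.1.+1 0) else (bottom k.1, bottom k.1.+1).
transitivity (\sum_(e in h @: setT) F e.1 e.2).
  apply: eq_bigl => -[u v] /=; apply/cross_stepP/imsetP => [[j [] [-> ->]]|].
  - by exists (j, true).
  - by exists (j, false).
  - by case=> -[j []] _ [-> ->]; exists j; [left|right].
rewrite big_imset /=.
  under eq_bigl do rewrite inE.
  rewrite -(pair_bigA _ (fun (j : 'I_m) (b : bool) => F (h (j, b)).1 (h (j, b)).2)) /=.
  by apply: eq_bigr => j _; rewrite big_bool.
have jm (j : 'I_m) : (j <= m)%N by exact: ltnW.
move=> [j b] [j' b'] _ _; rewrite /h /=.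
by case: b; case: b' => /(congr1 fst) /= /ladder_inj[] //= /val_inj->.
Qed.

Lemma sum_adjacent (V : nmodType) (F : location W -> location W -> V) :
  \sum_(e : location W * location W | adjacent e.1 e.2) F e.1 e.2 =
  \sum_(c < m.+1) \sum_(p < height c)
    (F (ladder c p) (ladder c p.+1) + F (ladder c p.+1) (ladder c p)) +
  \sum_(j < m)
    ((F (ladder j 0) (ladder j.+1 0) + F (ladder j.+1 0) (ladder j 0)) +
     (F (bottom j) (bottom j.+1) + F (bottom j.+1) (bottom j))).
Proof.
have swap (G : location W -> location W -> V) (P : rel (location W)) :
    \sum_(e : location W * location W | P e.2 e.1) G e.1 e.2 =
    \sum_(e : location W * location W | P e.1 e.2) G e.2 e.1.
  rewrite (reindex (fun e : location W * location W => (e.2, e.1))) //=.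
  by exists (fun e : location W * location W => (e.2, e.1)) => -[].
have aisleP u v : aisle_step u v -> col u = col v /\ pos v = (pos u).+1.
  case/aisle_stepP=> c [p [-> ->]].
  by rewrite !col_ladder ?pos_ladder //; [exact: ltnW | rewrite -ltnS..].
have crossP u v : cross_step u v -> col v = (col u).+1.
  by case/cross_stepP=> j [] [-> ->]; rewrite !col_ladder // ltnW.
have -> : \sum_(e : location W * location W | adjacent e.1 e.2) F e.1 e.2 =
    (\sum_(e : location W * location W | aisle_step e.1 e.2) F e.1 e.2 +
     \sum_(e : location W * location W | aisle_step e.2 e.1) F e.1 e.2) +
    (\sum_(e : location W * location W | cross_step e.1 e.2) F e.1 e.2 +
     \sum_(e : location W * location W | cross_step e.2 e.1) F e.1 e.2).
  rewrite [LHS]big_mkcond [X in X + _ + _]big_mkcond [X in _ + X + _]big_mkcond.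
  rewrite [X in _ + (X + _)]big_mkcond [X in _ + (_ + X)]big_mkcond -!big_split /=.
  apply: eq_bigr => -[u v] _ /=.
  rewrite /adjacent; have := aisleP u v; have := aisleP v u.
  have := crossP u v; have := crossP v u.
  (* The four kinds of arcs exclude each other: an aisle step keeps the column and raises the
     position by one, a cross step raises the column by one. *)
  case: (aisle_step u v) (aisle_step v u) (cross_step u v) (cross_step v u);
    case; case; case; rewrite /= ?add0r ?addr0 // => A1 A2 A3 A4; exfalso;
    try move: (A1 isT); try move: (A2 isT);
    try move: (A3 isT); try move: (A4 isT); lia.
rewrite (swap F (@aisle_step R m 1 W)) (swap F (@cross_step R m 1 W)).
rewrite !sum_aisle (sum_aisle (fun u v => F v u)) !sum_cross.
rewrite (sum_cross (fun u v => F v u)) -!big_split /=; congr (_ + _).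
  by apply: eq_bigr => c _; rewrite -big_split.
by apply: eq_bigr => j _; rewrite addrACA.
Qed.

Implicit Types (x : location W -> location W -> bool) (f : location W -> int).

(** * Flow conservation *)

Definition net x u v : int := (x u v : nat)%:Z - (x v u : nat)%:Z.

(* The net flow paired with the gradient of a test function; conservation at
   every location amounts to its vanishing for all [f]. *)
Definition divergence x f : int :=
  \sum_(c < m.+1) \sum_(p < height c)
    (f (ladder c p) - f (ladder c p.+1)) * net x (ladder c p) (ladder c p.+1) +
  \sum_(j < m)
    ((f (ladder j 0) - f (ladder j.+1 0)) * net x (ladder j 0) (ladder j.+1 0) +
     (f (bottom j) - f (bottom j.+1)) * net x (bottom j) (bottom j.+1)).

Definition balanced x := forall v,
  (\sum_(e in arcs_out [set v]) x e.1 e.2 = \sum_(e in arcs_in [set v]) x e.1 e.2)%N.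

Lemma divergenceE x f :
  divergence x f = \sum_(e : location W * location W | adjacent e.1 e.2)
                      (f e.1 - f e.2) * (x e.1 e.2 : nat)%:Z.
Proof.
rewrite (sum_adjacent (fun u v => (f u - f v) * (x u v : nat)%:Z)).
rewrite /divergence /net; congr (_ + _).
  by apply: eq_bigr => c _; apply: eq_bigr => p _; ring.
by apply: eq_bigr => j _; ring.
Qed.

Lemma sum_arcs_out1 x v :
  (\sum_(e in arcs_out [set v]) x e.1 e.2 =
   \sum_(e : location W * location W | adjacent e.1 e.2 && (e.1 == v)) x e.1 e.2)%N.
Proof.
apply: eq_bigl => -[u w]; rewrite !inE /=.
have [->|//] := eqVneq u v; case: eqP => [->|_]; last by rewrite !andbT.
by rewrite (negbTE (adjacent_irrefl v)).
Qed.

Lemma sum_arcs_in1 x v :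
  (\sum_(e in arcs_in [set v]) x e.1 e.2 =
   \sum_(e : location W * location W | adjacent e.1 e.2 && (e.2 == v)) x e.1 e.2)%N.
Proof.
apply: eq_bigl => -[u w]; rewrite !inE /=.
have [->|//] := eqVneq w v; last by rewrite !andbF.
case: eqP => [->|_]; last by rewrite !andbT.
by rewrite (negbTE (adjacent_irrefl v)).
Qed.

(** Summation by parts: grouping the arcs by tail and by head turns the pairing into outflow minus
    inflow, weighted by [f]. Conversely the indicator of a single location recovers conservation
    there. *)
Lemma balancedP x : balanced x <-> forall f, divergence x f = 0.
Proof.
have PoszS := big_morph Posz PoszD (erefl (0%N : int)).
have divE f : divergence x f =
    \sum_(e : location W * location W | adjacent e.1 e.2) f e.1 * (x e.1 e.2 : nat)%:Z -
    \sum_(e : location W * location W | adjacent e.1 e.2) f e.2 * (x e.1 e.2 : nat)%:Z.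
  by rewrite divergenceE -sumrB; apply: eq_bigr => e _; rewrite mulrBl.
split=> [bal f|div0 v].
  rewrite divE (partition_big fst predT) //= [X in _ - X](partition_big snd predT) //=.
  apply/eqP; rewrite subr_eq0; apply/eqP; apply: eq_bigr => v _.
  transitivity (f v * (\sum_(e in arcs_out [set v]) x e.1 e.2)%N%:Z).
    rewrite sum_arcs_out1 PoszS mulr_sumr.
    by apply: eq_bigr => e /andP[_ /eqP->].
  rewrite bal sum_arcs_in1 PoszS mulr_sumr.
  by apply: eq_bigr => e /andP[_ /eqP->].
have indic (P : pred (location W * location W)) :
    \sum_(e : location W * location W | adjacent e.1 e.2)
      (P e : nat)%:Z * (x e.1 e.2 : nat)%:Z =
    (\sum_(e : location W * location W | adjacent e.1 e.2 && P e) x e.1 e.2)%N%:Z.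
  rewrite PoszS big_mkcondr; apply: eq_bigr => e _.
  by case: (P e); rewrite ?mul1r ?mul0r.
have := divE (fun u => (u == v : nat)%:Z); rewrite div0 => /esym/eqP.
rewrite subr_eq0 (indic (fun e => e.1 == v)) (indic (fun e => e.2 == v)) eqz_nat.
by rewrite -sum_arcs_out1 -sum_arcs_in1 => /eqP.
Qed.

Lemma divergence_set x (S : {set location W}) :
  divergence x (fun u => (u \in S : nat)%:Z) =
  (\sum_(e in arcs_out S) x e.1 e.2)%N%:Z - (\sum_(e in arcs_in S) x e.1 e.2)%N%:Z.
Proof.
have PoszS := big_morph Posz PoszD (erefl (0%N : int)).
rewrite divergenceE !PoszS [X in _ = X - _]big_mkcond
  [X in _ = _ - X]big_mkcond [LHS]big_mkcond -sumrB.
apply: eq_bigr => -[u v] _; rewrite !inE /=.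
by case: (adjacent u v); case: (u \in S); case: (v \in S);
  rewrite ?subrr ?subr0 ?sub0r ?mul0r ?mul1r ?mulN1r.
Qed.

Lemma balanced_cut x (S : {set location W}) : balanced x ->
  (\sum_(e in arcs_out S) x e.1 e.2 = \sum_(e in arcs_in S) x e.1 e.2)%N.
Proof.
move=> /balancedP/(_ (fun u => (u \in S : nat)%:Z)).
by rewrite divergence_set => /eqP; rewrite subr_eq0 eqz_nat => /eqP.
Qed.

Lemma sum_arcs_gt0 x (A : {set location W * location W}) :
  reflect (exists u v, (u, v) \in A /\ x u v) (0 < \sum_(e in A) x e.1 e.2)%N.
Proof.
rewrite lt0n sum_nat_eq0 negb_forall_in.
apply: (iffP exists_inP) => [[[u v] uv xuv]|[u [v [uv xuv]]]].
  by exists u, v; split=> //; move: xuv => /=; case: (x u v).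
by exists (u, v) => //=; rewrite xuv.
Qed.

(** Outflow and inflow of a cut agree, so an arc entering [S] would force one leaving it. *)
Lemma closed_noncrossing x (S : {set location W}) : balanced x ->
  (forall u v, adjacent u v -> x u v -> u \in S -> v \in S) ->
  forall u v, adjacent u v -> x u v -> (u \in S) = (v \in S).
Proof.
move=> bal closed u v uv xuv; have cut := balanced_cut S bal.
apply/idP/idP => [|vS]; first exact: closed.
apply/negPn/negP => uS.
have : (0 < \sum_(e in arcs_in S) x e.1 e.2)%N.
  by apply/sum_arcs_gt0; exists u, v; rewrite inE /= uv uS vS.
rewrite -cut => /sum_arcs_gt0[u' [v' []]]; rewrite inE /= => /and3P[uv' uS' vS'].
by move=> /(closed _ _ uv')/(_ uS'); rewrite (negbTE vS').
Qed.

Lemma divergence_coord x (g : nat -> nat -> int) :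
  divergence x (fun u => g (col u) (pos u)) =
  \sum_(c < m.+1) \sum_(p < height c)
    (g c p - g c p.+1) * net x (ladder c p) (ladder c p.+1) +
  \sum_(j < m)
    ((g j 0 - g j.+1 0) * net x (ladder j 0) (ladder j.+1 0) +
     (g j (height j) - g j.+1 (height j.+1)) * net x (bottom j) (bottom j.+1)).
Proof.
congr (_ + _).
  apply: eq_bigr => c _; apply: eq_bigr => p _.
  rewrite !col_ladder ?leq_ord // (pos_ladder (ltn_ord p)) pos_ladder //.
  exact: ltnW.
apply: eq_bigr => j _; have jm : (j <= m)%N by exact: ltnW.
by rewrite !col_ladder // !pos_ladder.
Qed.

(** The first edge stands for the whole aisle: under conservation every edge of it carries the same
    net flow. *)
Definition aisle_flow x c := net x (ladder c 0) (ladder c 1).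

(** The test function is the indicator of positions 1 to [p] of the aisle; only the first edge and
    edge [p] leave this segment. For [p = 0] the segment is empty and both terms cancel. *)
Lemma net_aisle x c p : balanced x -> (c <= m)%N -> (p < height c)%N ->
  net x (ladder c p) (ladder c p.+1) = aisle_flow x c.
Proof.
move=> /balancedP bal cm ph.
have /esym := divergence_coord x
  (fun c' p' => ((c' == c) && (0 < p' <= p)%N : nat)%:Z).
rewrite bal [X in _ + X]big1 ?addr0 => [|j _]; last first.
  have E c' : ((c' == c) && (0 < height c' <= p)%N) = false.
    by apply/andP => -[/eqP->]; lia.
  by rewrite !andbF !E !subrr !mul0r addr0.
rewrite (bigD1 (Ordinal (cm : (c < m.+1)%N))) //= [X in _ + X]big1 ?addr0; last first.
  move=> i /eqP ic; rewrite big1 // => p' _.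
  have -> : (i == c :> nat) = false by apply/eqP => ?; apply: ic; apply: val_inj.
  by rewrite subrr mul0r.
rewrite eqxx /=.
under eq_bigr => p' _.
  have -> : ((0 < p' <= p)%N : nat)%:Z - ((p' < p)%N : nat)%:Z =
    (p' == p :> nat : nat)%:Z - (p' == 0 :> nat : nat)%:Z by lia.
  rewrite mulrBl.
  over.
rewrite sumrB (bigD1 (Ordinal ph)) //= [X in _ + X - _]big1; last first.
  move=> i /eqP ip; case: eqP => [?|]; last by rewrite mul0r.
  by case: ip; apply: val_inj.
rewrite (bigD1 (Ordinal (isT : (0 < height c)%N))) //= [X in _ - (_ + X)]big1; last first.
  move=> i /eqP ip; case: eqP => [?|]; last by rewrite mul0r.
  by case: ip; apply: val_inj.
by rewrite !eqxx !mul1r !addr0 => /eqP; rewrite subr_eq0 => /eqP.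
Qed.

(** The vertical cut to the right of aisle [j] meets only the two gap edges. *)
Lemma net_bottom x j : balanced x -> (j < m)%N ->
  net x (bottom j) (bottom j.+1) = - net x (ladder j 0) (ladder j.+1 0).
Proof.
move=> /balancedP bal jm.
have /esym := divergence_coord x (fun c _ => ((c <= j)%N : nat)%:Z).
rewrite bal big1 ?add0r => [|c _]; last first.
  by rewrite big1 // => p _; rewrite subrr mul0r.
rewrite (bigD1 (Ordinal jm)) //= [X in _ + X]big1 => [|i /eqP ij]; last first.
  have -> : (i < j)%N = (i <= j)%N.
    by rewrite ltn_neqAle; case: eqP => // ?; case: ij; apply: val_inj.
  by rewrite !subrr !mul0r addr0.
by rewrite leqnn ltnn /= !mul1r addr0 addrC => /eqP; rewrite addr_eq0 => /eqP.
Qed.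

(** The cut surrounds the northern ends of aisles 0 to [j]; flow leaves it only down these aisles or
    through the northern gap [j]. *)
Lemma net_top x j : balanced x -> (j < m)%N ->
  net x (ladder j 0) (ladder j.+1 0) = - \sum_(0 <= c < j.+1) aisle_flow x c.
Proof.
move=> /balancedP bal jm.
have /esym := divergence_coord x (fun c p => ((c <= j)%N && (p == 0) : nat)%:Z).
rewrite bal addrC (bigD1 (Ordinal jm)) //= [X in _ + X + _]big1; last first.
  move=> i /eqP ij.
  have -> : (i < j)%N = (i <= j)%N.
    by rewrite ltn_neqAle; case: eqP => // ?; case: ij; apply: val_inj.
  by rewrite !andbF !subrr !mul0r addr0.
rewrite leqnn ltnn /= mul1r mul0r !addr0.
move=> /eqP; rewrite addr_eq0 => /eqP ->; congr (- _).
rewrite (big_nat_widen _ _ m.+1) ?ltnS ?(ltnW jm) // [RHS]big_mkcond big_mkord.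
apply: eq_bigr => c _; rewrite ltnS big_ord_recl /= big1 => [|p _].
  by rewrite !andbF andbT subr0 addr0; case: (c <= j)%N; rewrite ?mul1r ?mul0r.
by rewrite !andbF subrr mul0r.
Qed.

(** The cut separates the northern cross-aisle from the rest. *)
Lemma sum_aisle_flow x : balanced x -> \sum_(0 <= c < m.+1) aisle_flow x c = 0.
Proof.
move=> /balancedP bal.
have /esym := divergence_coord x (fun _ p => ((p == 0)%N : nat)%:Z).
rewrite bal [X in _ + X]big1 ?addr0 => [|j _]; last first.
  by rewrite !subrr !mul0r addr0.
move=> E; rewrite -[RHS]E big_mkord; apply: eq_bigr => c _.
rewrite big_ord_recl /= big1 => [|p _].
  by rewrite subr0 addr0 mul1r.
by rewrite subrr mul0r.
Qed.

Lemma net_eq0 x u v : net x u v = 0 -> x u v = x v u.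
Proof. by rewrite /net; case: (x u v); case: (x v u). Qed.

(** * Lengths *)

Definition aisle_length c p : R := dist (ladder c p) (ladder c p.+1).

Definition gap_length j : R := dist (ladder j 0) (ladder j.+1 0).

Definition cost x : R :=
  \sum_(e : location W * location W | adjacent e.1 e.2)
    dist e.1 e.2 * (x e.1 e.2)%:R.

Definition multiplicity x u v : nat := (x u v + x v u)%N.

Lemma dist_sym u v : dist u v = dist v u.
Proof. by rewrite /dist distrC [X in _ + X]distrC. Qed.

Lemma ladder_pick c p : (0 < p < height c)%N ->
  exists q : 'I_(nloc W (column c)),
    p = q.+1 /\ ladder c p = inr (Tagged (fun i => 'I_(nloc W i)) q).
Proof.
case: p => // p /= ph; rewrite /ladder /loc_at; case: insubP => [q _ qp|].
  by exists q; rewrite qp.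
by rewrite -ltnS -/(height c) ph.
Qed.

Lemma ordinate_lt c p : (p < height c)%N ->
  ordinate (ladder c p) < ordinate (ladder c p.+1).
Proof.
have T0 : ordinate (ladder c 0) = cross_y W (widen_ord (leqnSn 1) (column c).2).
  by [].
have B1 : ordinate (bottom c) = cross_y W (lift ord0 (column c).2).
  by rewrite /bottom /ladder /height /= insubN // -leqNgt.
move=> ph; case: (posnP p) => [p0|p0].
  rewrite p0 T0; have [h1|h1] := eqVneq 1%N (height c).
    have -> : ladder c 1 = bottom c by rewrite /bottom -h1.
    by rewrite B1; apply: cross_y_lt.
  have [|q [_ ->]] := @ladder_pick c 1; first by rewrite /= ltn_neqAle h1 /height.
  by have /andP[] := loc_y_bounds q.
have [|q [pq ->]] := @ladder_pick c p; first by rewrite p0.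
have [h1|h1] := eqVneq p.+1 (height c).
  have -> : ladder c p.+1 = bottom c by rewrite /bottom -h1.
  by rewrite B1; have /andP[] := loc_y_bounds q.
have [|q' [pq' ->]] := @ladder_pick c p.+1; first by rewrite /= ltn_neqAle h1.
by apply: loc_y_lt; rewrite -ltnS -pq -pq'.
Qed.

Lemma abscissa_ladder c p : abscissa (ladder c p) = aisle_x W (inord c).
Proof.
by rewrite /ladder /loc_at; case: p => [|p] //; case: insubP.
Qed.

Lemma aisle_lengthE c p : (p < height c)%N ->
  aisle_length c p = ordinate (ladder c p.+1) - ordinate (ladder c p).
Proof.
move=> /ordinate_lt ylt; rewrite /aisle_length /dist !abscissa_ladder.
by rewrite subrr normr0 add0r ltr0_norm ?subr_lt0 // opprB.
Qed.

Lemma aisle_length_gt0 c p : (p < height c)%N -> 0 < aisle_length c p.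
Proof. by move=> ph; rewrite aisle_lengthE // subr_gt0 ordinate_lt. Qed.

(** The common length of all aisles, which makes savings in one aisle comparable with expenses in
    another. *)
Definition depth : R := cross_y W ord_max - cross_y W ord0.

Lemma ordinate_top c : ordinate (ladder c 0) = cross_y W ord0.
Proof. by congr (cross_y W _); apply: val_inj. Qed.

Lemma ordinate_bottom c : ordinate (bottom c) = cross_y W ord_max.
Proof.
rewrite /bottom /ladder /height /= insubN -?leqNgt //=.
by congr (cross_y W _); apply: val_inj.
Qed.

Lemma sum_aisle_length c : \sum_(p < height c) aisle_length c p = depth.
Proof.
transitivity (\sum_(0 <= p < height c)
    (ordinate (ladder c p.+1) - ordinate (ladder c p))).
  by rewrite big_mkord; apply: eq_bigr => p _; rewrite aisle_lengthE.
by rewrite telescope_sumr // ordinate_top -/(bottom c) ordinate_bottom.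
Qed.

Lemma dist_bottom j : dist (bottom j) (bottom j.+1) = gap_length j.
Proof.
rewrite /gap_length /dist !ordinate_bottom !ordinate_top !subrr.
by rewrite !abscissa_ladder.
Qed.

Lemma gap_length_ge0 j : 0 <= gap_length j.
Proof. by rewrite /gap_length /dist addr_ge0. Qed.

Definition aisle_cost x c : R := \sum_(p < height c)
  aisle_length c p * (multiplicity x (ladder c p) (ladder c p.+1))%:R.

Definition gap_multiplicity x j : nat :=
  (multiplicity x (ladder j 0) (ladder j.+1 0) +
   multiplicity x (bottom j) (bottom j.+1))%N.

Lemma costE x : cost x = \sum_(c < m.+1) aisle_cost x c +
  \sum_(j < m) gap_length j * (gap_multiplicity x j)%:R.
Proof.
rewrite /cost (sum_adjacent (fun u v => dist u v * (x u v)%:R)); congr (_ + _).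
  apply: eq_bigr => c _; apply: eq_bigr => p _.
  by rewrite [X in _ + X * _]dist_sym -mulrDr -natrD.
apply: eq_bigr => j _.
rewrite [X in (_ + X * _) + _]dist_sym [X in _ + (_ + X * _)]dist_sym dist_bottom.
by rewrite -/(gap_length j) -!mulrDr -!natrD.
Qed.

Lemma adjacent_aisle c p : (c <= m)%N -> (p < height c)%N ->
  adjacent (ladder c p) (ladder c p.+1).
Proof. by move=> cm ph; apply/adjacentP; left; exact: (AisleEdge cm ph erefl erefl). Qed.

Lemma adjacent_top j : (j < m)%N -> adjacent (ladder j 0) (ladder j.+1 0).
Proof. by move=> jm; apply/adjacentP; left; exact: (TopEdge jm erefl erefl). Qed.

Lemma adjacent_bottom j : (j < m)%N -> adjacent (bottom j) (bottom j.+1).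
Proof. by move=> jm; apply/adjacentP; left; exact: (BottomEdge jm erefl erefl). Qed.

(** * Tours *)

Definition active x u : bool := [exists v, adjacent u v && x u v].

(** The routing constraints of one picker in terms of its arcs alone: being [active] replaces the
    variable [y]. *)
Record tour x : Prop := Tour {
  tour_balanced : balanced x;
  tour_connected : forall (S : {set location W}) u,
    origin W \notin S -> u \in S -> active x u ->
    exists v w, (v, w) \in arcs_out S /\ x v w;
  tour_origin : active x (origin W)
}.

Lemma activeP x u : reflect (exists v, adjacent u v /\ x u v) (active x u).
Proof. by apply: (iffP existsP) => -[v]; [move/andP|move=> ?]; exists v => //; apply/andP. Qed.

Lemma active_arc x u v : adjacent u v -> x u v -> active x u.
Proof. by move=> uv xuv; apply/activeP; exists v. Qed.

Definition noncrossing x (S : {set location W}) :=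
  forall u v, adjacent u v -> x u v -> (u \in S) = (v \in S).

Lemma tour_noncrossing x (S : {set location W}) u : tour x -> noncrossing x S ->
  origin W \notin S -> active x u -> u \notin S.
Proof.
move=> [_ conn _] nS sS xu; apply/negP => uS.
have [v [w []]] := conn S u sS uS xu.
by rewrite inE /= => /and3P[vw vS /negP wS] /(nS _ _ vw); rewrite vS => /esym.
Qed.

(** Under conservation a set without outgoing arcs has no incoming ones either, so connectivity need
    only be tested on sets that no used arc crosses, regardless of direction. *)
Lemma noncrossing_tour x u : balanced x -> active x u ->
  (forall S w, noncrossing x S -> origin W \notin S -> active x w -> w \notin S) ->
  tour x.
Proof.
move=> bal xu nS.
have conn (S : {set location W}) w : origin W \notin S -> w \in S -> active x w ->
    exists v w', (v, w') \in arcs_out S /\ x v w'.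
  move=> sS wS xw; apply/sum_arcs_gt0; rewrite lt0n; apply/negP => /eqP out0.
  suff /nS/(_ sS xw) : noncrossing x S by rewrite wS.
  apply: closed_noncrossing => // v v' vv' xvv' vS; apply/negPn/negP => v'S.
  have : (0 < \sum_(e in arcs_out S) x e.1 e.2)%N.
    by apply/sum_arcs_gt0; exists v, v'; rewrite inE /= vv' vS v'S.
  by rewrite out0.
(* Were the origin inactive, no arc would enter it either, and its complement would be a noncrossing
   set containing the active location [u]. *)
split=> //; case: (boolP (active x (origin W))) => // xs.
suff : u \notin ~: [set origin W] by rewrite !inE negbK => /eqP us; rewrite -us xu in xs.
apply: nS => //; last by rewrite !inE eqxx.
apply: closed_noncrossing => // v v' vv' xvv' _; rewrite !inE; apply/eqP => v's.
have := bal (origin W).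
have -> : (\sum_(e in arcs_out [set origin W]) x e.1 e.2 = 0)%N.
  apply/eqP; rewrite -leqn0 leqNgt; apply/sum_arcs_gt0 => -[w [w' []]].
  rewrite !inE /= => /and3P[ww' /eqP ws _] xww'.
  by case/negP: xs; rewrite -ws; apply: active_arc xww'.
move/esym/eqP; rewrite -leqn0 leqNgt => /negP; apply; apply/sum_arcs_gt0.
exists v, v'; split=> //; rewrite !inE /= vv' v's eqxx andbT.
by apply/eqP => vs; case/negP: xs; rewrite -vs; apply: active_arc xvv'.
Qed.

Lemma balanced_net x x' :
  (forall u v, adjacent u v -> net x' u v = net x u v) -> balanced x -> balanced x'.
Proof.
move=> nE /balancedP bal; apply/balancedP => f; rewrite -(bal f).
congr (_ + _).
  apply: eq_bigr => c _; apply: eq_bigr => p _; rewrite nE //.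
  by rewrite adjacent_aisle ?leq_ord.
by apply: eq_bigr => j _; rewrite !nE ?adjacent_top ?adjacent_bottom.
Qed.

Lemma cost_lt x x' u v : (forall w w', x' w w' -> x w w') ->
  adjacent u v -> x u v -> ~~ x' u v -> 0 < dist u v -> cost x' < cost x.
Proof.
move=> le_x uv xuv x'uv d0; rewrite /cost.
rewrite (bigD1 (u, v)) //= [ltRHS](bigD1 (u, v)) //= xuv (negbTE x'uv).
rewrite mulr0 mulr1 add0r ltr_pwDl // ler_sum // => -[w w'] _ /=.
rewrite ler_wpM2l ?addr_ge0 // ler_nat.
by have := le_x w w'; case: (x' w w') => // ->.
Qed.

(** Since visited picking locations stay visited, the shorter tour can replace [x] without changing
    the assignment of orders. *)
Definition improvable x := exists x', [/\ tour x',
  forall w : picking W, active x (inr w) -> active x' (inr w) & cost x' < cost x].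

Definition doubled x c := forall p, (p < height c)%N ->
  x (ladder c p) (ladder c p.+1) /\ x (ladder c p.+1) (ladder c p).

Lemma noncrossing_edge x S u v : noncrossing x S -> adjacent u v ->
  x u v \/ x v u -> (u \in S) = (v \in S).
Proof.
move=> nS uv [xuv|xvu]; first exact: nS.
by apply/esym/nS; rewrite // adjacentC.
Qed.

Lemma noncrossing_aisle x S c q : noncrossing x S -> (c <= m)%N ->
  (q <= height c)%N ->
  (forall p, (p < q)%N -> x (ladder c p) (ladder c p.+1) \/ x (ladder c p.+1) (ladder c p)) ->
  forall p, (p <= q)%N -> (ladder c p \in S) = (ladder c 0 \in S).
Proof.
move=> nS cm qh xq; elim=> // p IH pq; rewrite -IH; last exact: ltnW.
apply/esym/(noncrossing_edge nS (adjacent_aisle cm _) (xq p pq)).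
exact: leq_trans qh.
Qed.

Lemma aisle_flow_doubled x c : doubled x c -> aisle_flow x c = 0.
Proof. by move=> /(_ 0%N isT)[]; rewrite /aisle_flow /net => -> ->. Qed.

Lemma pick_adjacent (w : picking W) v : adjacent (inr w) v ->
  [/\ col v = col (inr w), (0 < pos (inr w) < height (col (inr w)))%N &
      pos v = (pos (inr w)).+1 \/ pos (inr w) = (pos v).+1].
Proof.
have ph := pos_pick w.
move=> /adjacentP[] [c p cm pc uE vE|j jm uE vE|j jm uE vE].
- have pc' := ltnW pc; split=> //; rewrite uE vE ?col_ladder ?pos_ladder //; by left.
- by move: ph; rewrite uE pos_ladder.
- by move: ph; rewrite uE /bottom col_ladder ?pos_ladder ?ltnn ?andbF // ltnW.
- have pc' := ltnW pc; split=> //; rewrite uE vE ?col_ladder ?pos_ladder //; by right.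
- by move: ph; rewrite vE pos_ladder.
- by move: ph; rewrite vE /bottom col_ladder ?pos_ladder ?ltnn ?andbF.
Qed.

(** * Removing doubled edges *)

Lemma adjacent_col u v : adjacent u v -> col u = col v ->
  exists2 p, (p < height (col u))%N &
    (u = ladder (col u) p /\ v = ladder (col u) p.+1) \/
    (u = ladder (col u) p.+1 /\ v = ladder (col u) p).
Proof.
have E v1 v2 : edge_spec v1 v2 -> col v1 = col v2 ->
    exists2 p, (p < height (col v1))%N &
      v1 = ladder (col v1) p /\ v2 = ladder (col v1) p.+1.
  case=> [c p cm ph -> ->|j jm -> ->|j jm -> ->]; rewrite !col_ladder // ?(ltnW jm) //.
  - by exists p.
  - by move=> /eqP; rewrite ltn_eqF.
  - by move=> /eqP; rewrite ltn_eqF.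
move=> /adjacentP[] /E uv cE; first by have [p ph ?] := uv cE; exists p => //; left.
have [p] := uv (esym cE); rewrite -cE => ph [? ?].
by exists p => //; right.
Qed.

Lemma doubled_arc x u v : doubled x (col u) -> adjacent u v -> col u = col v -> x u v.
Proof.
by move=> dx uv /(adjacent_col uv)[p /dx[? ?] [] [uE vE]]; rewrite uE vE.
Qed.

Implicit Types (rem : rel (location W)) (S : {set location W}).

Definition remove x rem u v : bool := x u v && ~~ rem u v.

(** Deleted edges carry zero net flow and are deleted in both directions, so no net flow changes. *)
Lemma balanced_remove x rem : symmetric rem ->
  (forall u v, adjacent u v -> rem u v -> x u v = x v u) ->
  balanced x -> balanced (remove x rem).
Proof.
move=> symr eqr; apply: balanced_net => u v uv; rewrite /net /remove symr.
case r : (rem v u); last by rewrite !andbT.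
by rewrite !andbF /= (eqr u v) ?subrr // symr.
Qed.

Lemma remove_cost_lt x rem a : (a <= m)%N -> doubled x a ->
  rem (ladder a (height a).-1) (bottom a) -> cost (remove x rem) < cost x.
Proof.
move=> am dx ra; have h : ((height a).-1 < height a)%N by [].
apply: (cost_lt (u := ladder a (height a).-1) (v := bottom a)).
- by move=> w w' /andP[].
- exact: (adjacent_aisle am h).
- by have [] := dx _ h.
- by rewrite /remove ra andbF.
- exact: (aisle_length_gt0 h).
Qed.

(** The arc to the northern neighbour is the one that survives, since deletions take place at the
    southern end. *)
Lemma active_doubled x rem a (w : picking W) : doubled x a -> col (inr w) = a ->
  ~~ rem (inr w) (ladder a (pos (inr w : location W)).-1) -> active (remove x rem) (inr w).
Proof.
move=> dx wa nr; set u : location W := inr w in wa nr *.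
have ph : (0 < pos u < height a)%N by rewrite -wa pos_pick.
have am : (a <= m)%N by rewrite -wa col_le.
have ph1 : ((pos u).-1 < height a)%N by lia.
have uE : u = ladder a (pos u).-1.+1 by rewrite prednK -?wa ?ladderK; case/andP: ph.
have [_ xu] := dx _ ph1.
apply: (active_arc (v := ladder a (pos u).-1)).
  by rewrite {1}uE adjacentC adjacent_aisle.
by rewrite /remove nr andbT {1}uE.
Qed.

Lemma remove_noncrossing x rem S :
  noncrossing (remove x rem) S ->
  (forall u v, adjacent u v -> x u v -> rem u v -> (u \in S) = (v \in S)) ->
  noncrossing x S.
Proof.
move=> nS rS u v uv xuv; case r : (rem u v); first exact: rS.
by apply: nS; rewrite /remove ?xuv ?r.
Qed.

Lemma active_remove x rem u : active (remove x rem) u -> active x u.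
Proof. by case/activeP=> v [uv /andP[xuv _]]; apply: active_arc xuv. Qed.

(* A doubled aisle may be opened next to its southern end as soon as its two
   cross-aisles carry flow to the right: that flow must come back, so the two
   ends of the aisle remain connected. *)
Lemma improve_open x a : tour x -> (a < m)%N -> doubled x a -> (1 < height a)%N ->
  net x (ladder a 0) (ladder a.+1 0) != 0 -> improvable x.
Proof.
move=> tx am dx h1 flow; have am' := ltnW am.
(* Both positions are at least [height a - 1], so among arcs [rem] selects exactly the southernmost
   edge of aisle [a], in both directions. *)
pose rem u v := [&& col u == a, col v == a, (height a <= (pos u).+1)%N &
                    (height a <= (pos v).+1)%N].
have remC : symmetric rem by move=> u v; rewrite /rem; lia.
have remE u v : adjacent u v -> rem u v -> x u v.
  move=> uv /and4P[/eqP ua /eqP va _ _].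
  by apply: doubled_arc => //; rewrite ?ua.
have bal' : balanced (remove x rem).
  apply: balanced_remove (tour_balanced tx) => // u v uv r.
  by rewrite !remE // 1?remC 1?adjacentC.
have keep p : (p.+1 < height a)%N -> remove x rem (ladder a p) (ladder a p.+1).
  move=> ph; have [xp _] := dx p (ltnW ph); rewrite /remove xp /rem !col_ladder //.
  by rewrite !pos_ladder; lia.
exists (remove x rem); split; last first.
- apply: (remove_cost_lt am' dx); rewrite /rem !col_ladder // !pos_ladder //.
  by rewrite eqxx leqnn leqnSn.
- move=> w xw; have [wa|wa] := eqVneq (col (inr w)) a.
    apply: (active_doubled dx wa); rewrite /rem wa col_ladder // eqxx.
    have ph : (0 < pos (inr w : location W) < height a)%N.
      by rewrite -wa pos_pick.
    rewrite pos_ladder; lia.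
  case/activeP: xw => v [wv xwv]; apply: active_arc wv _.
  by rewrite /remove xwv /rem (negbTE wa).
apply: (noncrossing_tour (u := ladder a 0)) => //.
  by apply: active_arc (keep 0%N h1); rewrite adjacent_aisle.
move=> S w nS sS /active_remove; apply: (tour_noncrossing tx) => //.
have topS p : (p < height a)%N -> (ladder a p \in S) = (ladder a 0 \in S).
  move=> ph; apply: (noncrossing_aisle (q := (height a).-1) nS) => //; try lia.
  by move=> q qh; left; apply: keep; lia.
(* The test function is the indicator of the part of [S] to the right of aisle [a]. Only the two gap
   edges at [a] contribute; their net flows are opposite and nonzero, so their right ends lie on the
   same side of [S]. Both edges are used, hence so do their left ends, the two ends of the aisle. *)
have endsS : (ladder a 0 \in S) = (bottom a \in S).
  have off u v : rem u v = false -> adjacent u v -> net x u v != 0 ->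
      (u \in S) = (v \in S).
    move=> r uv; rewrite /net => nuv; apply: (noncrossing_edge nS uv).
    rewrite /remove (remC v u) r !andbT.
    by move: nuv; case: (x u v); [left|case: (x v u); [right|]].
  have term (f := fun u => ((u \in S) && (a < col u)%N : nat)%:Z) u v :
      adjacent u v -> (a < col u)%N = (a < col v)%N ->
      (f u - f v) * net x u v = 0.
    move=> uv; rewrite /f => <-; have [ua|_] := ltnP a (col u); last first.
      by rewrite !andbF subrr mul0r.
    have r : rem u v = false by rewrite /rem gtn_eqF.
    have [->|/(off _ _ r uv) ->] := eqVneq (net x u v) 0; first by rewrite mulr0.
    by rewrite subrr mul0r.
  have := proj1 (balancedP x) (tour_balanced tx)
    (fun u => ((u \in S) && (a < col u)%N : nat)%:Z).
  rewrite /divergence big1 ?add0r => [|c _]; last first.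
    rewrite big1 // => p _; apply: term; first by rewrite adjacent_aisle ?leq_ord.
    by rewrite !col_ladder ?leq_ord.
  rewrite (bigD1 (Ordinal am)) //= [X in _ + X]big1 ?addr0 => [|j /eqP ja]; last first.
    have jm : (j <= m)%N by exact: ltnW.
    have ja' : j <> a :> nat by move=> ?; apply: ja; apply: val_inj.
    by rewrite !term ?adjacent_top ?adjacent_bottom ?col_ladder //; lia.
  rewrite !col_ladder // ltnn leqnn !andbF !andbT !sub0r.
  rewrite (net_bottom (tour_balanced tx) am) mulrNN mulNr addrC -mulrBl.
  move/eqP; rewrite mulf_eq0 (negbTE flow) orbF subr_eq0 eqz_nat => /eqP endsE.
  have r0 u v : adjacent u v -> col u = a -> col v = a.+1 -> rem u v = false.
    by rewrite /rem => _ _ ->; lia.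
  rewrite (off (ladder a 0) (ladder a.+1 0)) ?r0 ?col_ladder ?adjacent_top //.
  rewrite (off (bottom a) (bottom a.+1)) ?r0 ?col_ladder ?adjacent_bottom //.
    by move: endsE; do 2!case: (_ \in S).
  by rewrite net_bottom ?oppr_eq0 //; apply: tour_balanced.
apply: (remove_noncrossing nS) => u v uv _ /and4P[/eqP ua /eqP va pu pv].
have E p : (p <= height a)%N -> (ladder a p \in S) = (ladder a 0 \in S).
  by rewrite leq_eqVlt => /orP[/eqP->|/topS//]; rewrite -endsS.
have := ladderK u; have := ladderK v; rewrite ua va => <- <-.
by rewrite !E //; [rewrite -va pos_le | rewrite -ua pos_le].
Qed.

Definition empty_aisle x c := forall p, (p < height c)%N ->
  multiplicity x (ladder c p) (ladder c p.+1) = 0%N.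

Lemma multiplicity_eq0 x u v : multiplicity x u v = 0%N -> x u v = false /\ x v u = false.
Proof. by rewrite /multiplicity; case: (x u v); case: (x v u). Qed.

Lemma aisle_flow_empty x c : empty_aisle x c -> aisle_flow x c = 0.
Proof. by move=> /(_ 0%N isT)/multiplicity_eq0[]; rewrite /aisle_flow /net => -> ->. Qed.

(* When no other aisle is used, the bottom cross-aisle is useless. *)
Lemma improve_drop x a : tour x -> (a <= m)%N -> doubled x a -> (1 < height a)%N ->
  (forall c, (c <= m)%N -> c != a -> empty_aisle x c) -> improvable x.
Proof.
move=> tx am dx h1 emp.
pose isbot u := pos u == height (col u).
(* All edges touching the southern cross-aisle go, including the last edge of every aisle. *)
pose rem u v := isbot u || isbot v.
have bal := tour_balanced tx.
have remC : symmetric rem by move=> u v; rewrite /rem orbC.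
have flow0 c : (c <= m)%N -> aisle_flow x c = 0.
  move=> cm; have [->|ca] := eqVneq c a; first exact: aisle_flow_doubled.
  exact/aisle_flow_empty/emp.
have aisleE u v : adjacent u v -> x u v -> col u = col v -> col u = a.
  move=> uv xuv cE; apply/eqP/negPn/negP => ua.
  have [p ph [] [uE vE]] := adjacent_col uv cE;
    have [] := multiplicity_eq0 (emp _ (col_le u) ua p ph); by rewrite -uE -vE xuv.
(* Every aisle is doubled or empty, so no edge carries net flow and each is used in both directions
   or in none. *)
have net0 u v : edge_spec u v -> x u v = x v u.
  case=> [c p cm ph -> ->|j jm -> ->|j jm -> ->]; apply: net_eq0.
  - by rewrite net_aisle // flow0.
  - by rewrite net_top // big_nat big1 ?oppr0 // => c cj; apply: flow0; lia.
  - rewrite net_bottom // net_top // opprK big_nat big1 // => c cj.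
    by apply: flow0; lia.
have bal' : balanced (remove x rem).
  apply: balanced_remove bal => // u v /adjacentP[] /net0 // ->; exact.
have keep p : (p.+1 < height a)%N -> remove x rem (ladder a p) (ladder a p.+1).
  move=> ph; have [xp _] := dx p (ltnW ph); rewrite /remove xp /rem /isbot.
  rewrite !col_ladder // !pos_ladder; lia.
exists (remove x rem); split; last first.
- apply: (remove_cost_lt am dx); rewrite /rem /isbot /bottom orbC.
  by rewrite col_ladder // pos_ladder ?eqxx.
- move=> w xw; have wa : col (inr w) = a.
    case/activeP: xw => v [wv xwv]; apply: (aisleE _ v) => //.
    by case: (pick_adjacent wv).
  apply: (active_doubled dx wa); have ph := pos_pick w.
  rewrite wa in ph; rewrite /rem /isbot wa col_ladder // pos_ladder; lia.
apply: (noncrossing_tour (u := ladder a 0)) => //.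
  by apply: active_arc (keep 0%N h1); rewrite adjacent_aisle.
move=> S w nS sS xw.
(* The southern cross-aisle is put on the side of the northern end of [a]. Used edges reach it from
   the rest only through aisle [a], so no arc of [x] crosses the modified set. *)
pose S' := [set u | if isbot u then ladder a 0 \in S else u \in S].
have wb : ~~ isbot w.
  by case/activeP: xw => v [_ /andP[_]]; rewrite negb_or => /andP[].
have -> : (w \in S) = (w \in S') by rewrite inE (negbTE wb).
apply: (tour_noncrossing tx _ _ (active_remove xw)); last first.
  by rewrite inE /isbot.
have mixed u v : adjacent u v -> x u v -> ~~ isbot u -> isbot v ->
    (u \in S) = (ladder a 0 \in S).
  move=> uv xuv ub vb.
  have cE : col u = col v.
    apply/eqP/negPn/negP => /eqP cE; move: ub vb cE; rewrite /isbot.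
    case/adjacentP: uv => [] [c p cm ph -> ->|j jm -> ->|j jm -> ->];
    by rewrite /bottom !col_ladder ?pos_ladder ?eqxx // ltnW.
  have ua := aisleE _ _ uv xuv cE; have := ladderK u; rewrite ua => <-.
  apply: (noncrossing_aisle (q := (height a).-1) nS) => //.
    by move=> q qh; left; apply: keep; lia.
  by move: ub (pos_le u); rewrite /isbot ua; lia.
move=> u v uv xuv; rewrite !inE.
case: ifPn => ub; case: ifPn => vb //.
- by rewrite (mixed v u) // 1?adjacentC //; case/adjacentP: uv xuv => /net0 ->.
- exact: mixed vb.
- by apply: nS; rewrite // /remove xuv /rem negb_or ub.
Qed.

(** * Toggling two aisles *)

Lemma aisle_cost_const x c k :
  (forall p, (p < height c)%N -> multiplicity x (ladder c p) (ladder c p.+1) = k) ->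
  aisle_cost x c = depth * k%:R.
Proof.
move=> mk; rewrite -(sum_aisle_length c) mulr_suml.
by apply: eq_bigr => p _; rewrite mk.
Qed.

Lemma aisle_cost_lt x c k q :
  (forall p, (p < height c)%N -> (multiplicity x (ladder c p) (ladder c p.+1) <= k)%N) ->
  (q < height c)%N -> (multiplicity x (ladder c q) (ladder c q.+1) < k)%N ->
  aisle_cost x c < depth * k%:R.
Proof.
move=> mk qh mq; rewrite -(sum_aisle_length c) mulr_suml /aisle_cost.
rewrite (bigD1 (Ordinal qh)) //= [ltRHS](bigD1 (Ordinal qh)) //=.
apply: ltr_leD; first by rewrite ltr_pM2l ?ltr_nat ?aisle_length_gt0.
apply: ler_sum => p _; rewrite ler_wpM2l ?ler_nat ?mk //.
exact/ltW/aisle_length_gt0.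
Qed.

Lemma aisle_cost_gt0 x c q : (q < height c)%N ->
  (0 < multiplicity x (ladder c q) (ladder c q.+1))%N -> 0 < aisle_cost x c.
Proof.
move=> qh mq; rewrite /aisle_cost (bigD1 (Ordinal qh)) //= ltr_pwDl //.
  by rewrite mulr_gt0 ?ltr0n ?aisle_length_gt0.
by apply: sumr_ge0 => p _; rewrite mulr_ge0 // ltW // aisle_length_gt0.
Qed.

Lemma multiplicity_le2 x u v : (multiplicity x u v <= 2)%N.
Proof. by rewrite /multiplicity; case: (x u v); case: (x v u). Qed.

(** The columns right of the gap contain an active location but not the origin, so connectivity
    yields an arc back across the gap; zero net flow on both gap edges supplies its reverse. *)
Lemma gap_multiplicity_ge2 x j u : tour x -> (j < m)%N -> (j < col u)%N ->
  active x u -> net x (ladder j 0) (ladder j.+1 0) = 0 -> (2 <= gap_multiplicity x j)%N.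
Proof.
move=> tx jm ju xu net0; have [|||v [w [vw xvw]]] :=
    tour_connected tx (S := [set v | (j < col v)%N]) (u := u); rewrite ?inE //.
have top2 := net_eq0 net0.
have bot2 : x (bottom j) (bottom j.+1) = x (bottom j.+1) (bottom j).
  by apply: net_eq0; rewrite net_bottom ?net0 ?oppr0 //; apply: tour_balanced.
move: vw; rewrite !inE /= -leqNgt => /and3P[/adjacentP vw vj wj].
rewrite /gap_multiplicity /multiplicity top2 bot2.
have E i : (i < m)%N -> (j < i.+1)%N -> (i <= j)%N -> i = j by lia.
have colE v1 v2 : edge_spec v1 v2 -> (col v1 <= col v2)%N.
  case=> [c p cm ph -> ->|i im -> ->|i im -> ->]; first by rewrite !col_ladder.
    by have im' := ltnW im; rewrite !col_ladder.
  by have im' := ltnW im; rewrite !col_ladder.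
case: vw => vw; first by have := colE _ _ vw; lia.
case: vw vj wj xvw => [c p cm ph -> ->|i im -> ->|i im -> ->].
- by rewrite !col_ladder //; lia.
- have im' := ltnW im; rewrite !col_ladder // => ji ij; rewrite (E i) // => ->; lia.
- have im' := ltnW im; rewrite !col_ladder // => ji ij; rewrite (E i) // => ->; lia.
Qed.

Definition sgn (d : bool) : int := if d then 1 else -1.

(* Adds a unit circulation along the rectangle bounded by aisles [a] and [c],
   running south in aisle [a] when [d] holds. Aisle [a] was doubled and becomes
   a single traversal; aisle [c] becomes a single traversal too, unless it
   already carried the opposite flow ([odd]), in which case it is doubled except
   for its southernmost edge. *)
Definition toggle x a c (odd d : bool) u v : bool :=
  if col u == col v then
    if col u == a then d == (pos u < pos v)%N
    else if col u == c then
      if odd then (pos u < height c)%N && (pos v < height c)%N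
      else d != (pos u < pos v)%N
    else x u v
  else if (minn a c <= minn (col u) (col v))%N && (maxn (col u) (col v) <= maxn a c)%N
  then ((col u < col v)%N == (a < c)%N) (+) d (+) (pos u != 0%N)
  else x u v.

Section Toggle.
Variables (x : location W -> location W -> bool) (a c : nat) (odd d : bool).
Hypotheses (am : (a <= m)%N) (cm : (c <= m)%N) (ac : a != c).
Let y := toggle x a c odd d.

Lemma toggle_first p : (p < height a)%N ->
  y (ladder a p) (ladder a p.+1) = d /\ y (ladder a p.+1) (ladder a p) = ~~ d.
Proof.
move=> ph; have ph' := ltnW ph; rewrite /y /toggle !col_ladder // !pos_ladder //.
by rewrite !eqxx ltnSn ltnNge leqnSn; case: d.
Qed.

Lemma toggle_second p : (p < height c)%N ->
  y (ladder c p) (ladder c p.+1) = (if odd then (p.+1 < height c)%N else ~~ d) /\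
  y (ladder c p.+1) (ladder c p) = (if odd then (p.+1 < height c)%N else d).
Proof.
move=> ph; have ph' := ltnW ph; rewrite /y /toggle !col_ladder // !pos_ladder //.
rewrite !eqxx [c == a]eq_sym (negbTE ac) ltnSn [(p.+1 < p)%N]ltnNge leqnSn ph.
by case: odd; rewrite ?andbT //; case: d.
Qed.

Lemma toggle_other u v : col u = col v -> col u != a -> col u != c -> y u v = x u v.
Proof. by move=> cE ua uc; rewrite /y /toggle cE eqxx -cE (negbTE ua) (negbTE uc). Qed.

Lemma toggle_outside u v : col u != col v ->
  (minn (col u) (col v) < minn a c)%N || (maxn a c < maxn (col u) (col v))%N ->
  y u v = x u v.
Proof.
move=> cE out; rewrite /y /toggle (negbTE cE); case: ifP => // /andP[].
by case/orP: out; rewrite ltnNge => /negbTE->.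
Qed.

(** The bit [(a < c) (+) d] tells whether the circulation runs to the right on the northern
    cross-aisle; on the southern one it runs the other way. *)
Lemma toggle_inside j : (j < m)%N -> (minn a c <= j < maxn a c)%N ->
  [/\ y (ladder j 0) (ladder j.+1 0) = (a < c)%N (+) d,
      y (ladder j.+1 0) (ladder j 0) = ~~ ((a < c)%N (+) d),
      y (bottom j) (bottom j.+1) = ~~ ((a < c)%N (+) d) &
      y (bottom j.+1) (bottom j) = (a < c)%N (+) d].
Proof.
move=> jm /andP[lj jh]; have jm' := ltnW jm.
have E1 : minn j j.+1 = j by rewrite (minn_idPl _).
have E2 : maxn j j.+1 = j.+1 by rewrite (maxn_idPr _).
have E3 : (j == j.+1) = false by rewrite ltn_eqF.
have E4 : (j.+1 < j)%N = false by rewrite ltnNge leqnSn.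
rewrite /y /toggle /bottom !col_ladder // ![pos (ladder _ _)]pos_ladder //.
rewrite ![j.+1 == j]eq_sym E3 [maxn j.+1 j]maxnC [minn j.+1 j]minnC E1 E2 lj jh.
by rewrite ltnSn E4 /= ; case: (a < c)%N; case: d.
Qed.

Hypothesis flow_c : aisle_flow x c = if odd then sgn d else 0.
Hypothesis dx : doubled x a.
Hypothesis flow0 : forall j, (minn a c <= j < maxn a c)%N ->
  net x (ladder j 0) (ladder j.+1 0) = 0.
Hypothesis bal : balanced x.

Lemma inside_lt j : (minn a c <= j < maxn a c)%N -> (j < m)%N.
Proof. by move: am cm; lia. Qed.

Lemma net_toggle_aisle i p : (i <= m)%N -> (p < height i)%N ->
  net y (ladder i p) (ladder i p.+1) =
  net x (ladder i p) (ladder i p.+1) + sgn d * ((i == a)%:Z - (i == c)%:Z).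
Proof.
move=> im ph; have [ia|ia] := eqVneq i a.
  rewrite ia in ph *; have [xd xu] := dx ph; have [yd yu] := toggle_first ph.
  by rewrite /net xd xu yd yu (negbTE ac); case: d.
have [ic|ic] := eqVneq i c; last first.
  by rewrite subrr mulr0 addr0 /net !toggle_other ?col_ladder.
rewrite ic in ph *; rewrite (net_aisle bal cm ph) flow_c /net.
have [-> ->] := toggle_second ph.
by case: odd; case: d; case: (p.+1 < height c)%N.
Qed.

Lemma net_toggle_gap j : (j < m)%N ->
  let s := sgn ((a < c)%N (+) d) * ((minn a c <= j < maxn a c)%N : nat)%:Z in
  net y (ladder j 0) (ladder j.+1 0) = net x (ladder j 0) (ladder j.+1 0) + s /\
  net y (bottom j) (bottom j.+1) = net x (bottom j) (bottom j.+1) - s.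
Proof.
move=> jm /=; have [inj|outj] := boolP (minn a c <= j < maxn a c)%N.
  have [y1 y2 y3 y4] := toggle_inside jm inj.
  rewrite (net_bottom bal jm) (flow0 inj) /net y1 y2 y3 y4.
  by case: (_ (+) _).
rewrite mulr0 subr0 addr0 /net; have jm' := ltnW jm.
by rewrite !toggle_outside // /bottom !col_ladder //; move: outj; lia.
Qed.

(** Let [h j] be the drop of [f] along aisle [j]. The circulation adds [sgn d * (h a - h c)] over
    the aisles and, by telescoping over the enclosed gaps, its opposite over the cross-aisles. *)
Lemma toggle_balanced : balanced y.
Proof.
apply/balancedP => f.
have [h hE] : exists h, forall j, h j = f (ladder j 0) - f (bottom j) by eexists.
have aisles : \sum_(i < m.+1) \sum_(p < height i)
    (f (ladder i p) - f (ladder i p.+1)) * net y (ladder i p) (ladder i p.+1) =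
  \sum_(i < m.+1) \sum_(p < height i)
    (f (ladder i p) - f (ladder i p.+1)) * net x (ladder i p) (ladder i p.+1) +
  sgn d * (h a - h c).
  have -> : h a - h c = \sum_(i < m.+1) ((i == a :> nat)%:Z - (i == c :> nat)%:Z) * h i.
    under eq_bigr do rewrite mulrBl.
    rewrite sumrB (bigD1 (Ordinal (am : (a < m.+1)%N))) //= big1 => [|i /eqP ia]; last first.
      by case: eqP => [?|]; [case: ia; apply: val_inj | rewrite mul0r].
    rewrite [X in _ = _ - X](bigD1 (Ordinal (cm : (c < m.+1)%N))) //= [X in _ - (_ + X)]big1.
      by rewrite !eqxx !mul1r !addr0.
    move=> i /eqP ic.
    by case: eqP => [?|]; [case: ic; apply: val_inj | rewrite mul0r].
  rewrite mulr_sumr -big_split; apply: eq_bigr => i _.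
  have im : (i <= m)%N by rewrite leq_ord.
  have -> : h i = \sum_(p < height i) (f (ladder i p) - f (ladder i p.+1)).
    rewrite hE /bottom -opprB -(telescope_sumr (fun p => f (ladder i p)) (leq0n _)).
    by rewrite big_mkord -sumrN; apply: eq_bigr => p _; rewrite opprB.
  rewrite !mulr_sumr -big_split; apply: eq_bigr => p _ /=.
  rewrite mulrA [_ * (f _ - f _)]mulrC -mulrDr; congr (_ * _).
  exact: net_toggle_aisle.
have gaps : \sum_(j < m)
    ((f (ladder j 0) - f (ladder j.+1 0)) * net y (ladder j 0) (ladder j.+1 0) +
     (f (bottom j) - f (bottom j.+1)) * net y (bottom j) (bottom j.+1)) =
  \sum_(j < m)
    ((f (ladder j 0) - f (ladder j.+1 0)) * net x (ladder j 0) (ladder j.+1 0) +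
     (f (bottom j) - f (bottom j.+1)) * net x (bottom j) (bottom j.+1)) +
  sgn ((a < c)%N (+) d) * (h (minn a c) - h (maxn a c)).
  have -> : h (minn a c) - h (maxn a c) =
      \sum_(j < m) ((minn a c <= j < maxn a c)%N : nat)%:Z * (h j - h j.+1).
    rewrite -(big_mkord xpredT
      (fun j => ((minn a c <= j < maxn a c)%N : nat)%:Z * (h j - h j.+1))).
    have lo : (minn a c <= m)%N by lia.
    have hi : (maxn a c <= m)%N by lia.
    have lohi : (minn a c <= maxn a c)%N by lia.
    rewrite (big_cat_nat (leq0n _) lo) (big_cat_nat lohi hi) /=.
    rewrite big_nat big1 ?add0r => [|j j_lo]; last first.
      by rewrite leqNgt; case: ltnP => //; rewrite ?mul0r; lia.
    rewrite [X in _ = _ + X]big_nat [X in _ = _ + X]big1 ?addr0 => [|j /andP[jh _]]; last first.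
      by rewrite [(j < _)%N]ltnNge jh andbF mul0r.
    rewrite -opprB -(telescope_sumr h lohi) -sumrN [LHS]big_nat [RHS]big_nat.
    by apply: eq_bigr => j ->; rewrite mul1r opprB.
  rewrite mulr_sumr -big_split; apply: eq_bigr => j _.
  have /= [-> ->] := net_toggle_gap (ltn_ord j).
  rewrite !hE; move: (sgn _) (Posz (_ && _)) => s e; ring.
rewrite -(proj1 (balancedP x) bal f) /divergence aisles gaps.
have -> : sgn ((a < c)%N (+) d) * (h (minn a c) - h (maxn a c)) = - (sgn d * (h a - h c)).
  have [ltac|ltca|e] := ltngtP a c; last by case/eqP: ac.
    by rewrite /sgn; case: d => /=; ring.
  by rewrite /sgn; case: d => /=; ring.
ring.
Qed.

(** Every edge of the rectangle is used by [y], except the last edge of [c] in the odd case, whose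
    ends remain joined through the rest of the rectangle. *)
Lemma toggle_loop S : noncrossing y S ->
  [/\ forall p, (p <= height a)%N -> (ladder a p \in S) = (ladder a 0 \in S),
      forall p, (p <= height c)%N -> (ladder c p \in S) = (ladder a 0 \in S) &
      forall j, (minn a c <= j <= maxn a c)%N ->
        (ladder j 0 \in S) = (ladder a 0 \in S) /\
        (bottom j \in S) = (ladder a 0 \in S)].
Proof.
move=> nS.
have Sa p : (p <= height a)%N -> (ladder a p \in S) = (ladder a 0 \in S).
  apply: (noncrossing_aisle nS) => // q qh; have [-> ->] := toggle_first qh.
  by case: d; [left|right].
have gap k : (minn a c + k <= maxn a c)%N ->
    (ladder (minn a c + k) 0 \in S) = (ladder (minn a c) 0 \in S) /\
    (bottom (minn a c + k) \in S) = (bottom (minn a c) \in S).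
  elim: k => [|k IH]; first by rewrite addn0.
  rewrite addnS => kh; have [|<- <-] := IH; first exact: ltnW.
  have inj : (minn a c <= minn a c + k < maxn a c)%N by rewrite leq_addr.
  have jm := inside_lt inj; have [y1 y2 y3 y4] := toggle_inside jm inj.
  split; apply/esym/(noncrossing_edge nS).
  - exact: adjacent_top.
  - by rewrite y1 y2; case: (_ (+) _); [left|right].
  - exact: adjacent_bottom.
  - by rewrite y3 y4; case: (_ (+) _); [right|left].
have range j : (minn a c <= j <= maxn a c)%N ->
    (ladder j 0 \in S) = (ladder (minn a c) 0 \in S) /\
    (bottom j \in S) = (bottom (minn a c) \in S).
  by move=> /andP[lj jh]; rewrite -(subnKC lj); apply: gap; rewrite subnKC.
have Sj j : (minn a c <= j <= maxn a c)%N ->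
    (ladder j 0 \in S) = (ladder a 0 \in S) /\ (bottom j \in S) = (ladder a 0 \in S).
  move=> /range[-> ->]; have [|Ta Ba] := range a; first by rewrite geq_minl leq_maxl.
  by split; [rewrite Ta | rewrite -Ba Sa].
split=> // p ph; have [|tc bc] := Sj c; first by rewrite geq_minr leq_maxr.
have [oddT|oddF] := boolP odd.
  move: ph; rewrite leq_eqVlt => /orP[/eqP-> //|ph]; rewrite -tc.
  apply: (noncrossing_aisle (q := (height c).-1) nS) => // q qh; left.
  have qh' : (q.+1 < height c)%N by move: qh; rewrite /height.
  by have [-> _] := toggle_second (ltnW qh'); rewrite oddT.
rewrite -tc; apply: (noncrossing_aisle nS) ph => // q qh.
have [-> ->] := toggle_second qh; rewrite (negbTE oddF).
by case: d; [right|left].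
Qed.

(** Arcs are altered only on the rectangle, which lies entirely on one side of [S]. *)
Lemma toggle_changed S u v : noncrossing y S -> adjacent u v ->
  y u v = x u v \/ (u \in S) = (ladder a 0 \in S) /\ (v \in S) = (ladder a 0 \in S).
Proof.
move=> nS uv; have [Sa Sc Sj] := toggle_loop nS.
have [cE|cE] := eqVneq (col u) (col v).
  have [ua|ua] := eqVneq (col u) a.
    right; rewrite -(ladderK u) -(ladderK v) -cE ua.
    by rewrite !Sa //; [rewrite -ua cE | rewrite -ua]; exact: pos_le.
  have [uc|uc] := eqVneq (col u) c.
    right; rewrite -(ladderK u) -(ladderK v) -cE uc.
    by rewrite !Sc //; [rewrite -uc cE | rewrite -uc]; exact: pos_le.
  by left; apply: toggle_other.
have [out|inn] := boolP ((minn (col u) (col v) < minn a c) ||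
                         (maxn a c < maxn (col u) (col v)))%N.
  by left; apply: toggle_outside.
have E v1 v2 : edge_spec v1 v2 -> col v1 != col v2 ->
    ~~ ((minn (col v1) (col v2) < minn a c) || (maxn a c < maxn (col v1) (col v2)))%N ->
    (v1 \in S) = (ladder a 0 \in S) /\ (v2 \in S) = (ladder a 0 \in S).
  case=> [i p im ph -> ->|j jm -> ->|j jm -> ->]; first by rewrite !col_ladder ?eqxx.
    have jm' := ltnW jm; rewrite !col_ladder // => _ inj.
    have [|-> _] := Sj j; first by lia.
    by have [|-> _] := Sj j.+1; first by lia.
  have jm' := ltnW jm; rewrite !col_ladder // => _ inj.
  have [|_ ->] := Sj j; first by lia.
  by have [|_ ->] := Sj j.+1; first by lia.
right; case/adjacentP: uv => /E; first exact.
by rewrite eq_sym minnC [maxn (col v) _]maxnC => /(_ cE inn)[].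
Qed.

Hypothesis tx : tour x.

Lemma active_first : active x (ladder a 0).
Proof.
have [xd _] := dx (isT : (0 < height a)%N).
by apply: active_arc xd; rewrite adjacent_aisle.
Qed.

(** A set noncrossing for [y] is noncrossing for [x] too, as altered arcs have both ends on one
    side. A location active through an altered arc is on the side of [ladder a 0], which is active
    in [x]. *)
Lemma toggle_tour : tour y.
Proof.
have [yd yu] := toggle_first (isT : (0 < height a)%N).
have [u yu'] : exists u, active y u.
  have aa : adjacent (ladder a 0) (ladder a 1) by rewrite adjacent_aisle.
  case: d yd yu => yd yu; first by exists (ladder a 0); apply: active_arc yd.
  by exists (ladder a 1); apply: active_arc yu; rewrite adjacentC.
apply: (noncrossing_tour toggle_balanced yu') => S w nS sS /activeP[v [wv ywv]].
have nx : noncrossing x S.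
  move=> u1 v1 uv xuv; have [E|[-> ->] //] := toggle_changed nS uv.
  by apply: nS; rewrite ?E.
have [E|[-> _]] := toggle_changed nS wv; last first.
  exact: tour_noncrossing tx nx sS active_first.
by apply: (tour_noncrossing tx nx sS); apply: active_arc wv _; rewrite -E.
Qed.

(** In a single traversal a location is left along the direction of travel; in the odd case it is
    left northward, since only the southernmost edge of [c] is missing. *)
Lemma toggle_active (w : picking W) : active x (inr w) -> active y (inr w).
Proof.
have ph := pos_pick w; set u : location W := inr w in ph *.
have south i : col u = i -> (i <= m)%N ->
    y (ladder i (pos u)) (ladder i (pos u).+1) -> active y u.
  move=> ui im yu; rewrite -(ladderK u) ui; apply: active_arc yu.
  by apply: adjacent_aisle => //; rewrite -ui; case/andP: ph.
have north i : col u = i -> (i <= m)%N ->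
    y (ladder i (pos u).-1.+1) (ladder i (pos u).-1) -> active y u.
  move=> ui im yu; rewrite -(ladderK u) ui.
  rewrite -{1}(prednK (proj1 (andP ph))); apply: active_arc yu.
  by rewrite adjacentC; apply: adjacent_aisle => //; rewrite -ui; lia.
have [ua|ua] := eqVneq (col u) a.
  have ph0 : (pos u < height a)%N by rewrite -ua; case/andP: ph.
  have ph1 : ((pos u).-1 < height a)%N by lia.
  have [y1 _] := toggle_first ph0; have [_ y2] := toggle_first ph1.
  move=> _; case: d y1 y2 => y1 y2; [exact: (south a)|exact: (north a)].
have [uc|uc] := eqVneq (col u) c.
  have ph0 : (pos u < height c)%N by rewrite -uc; case/andP: ph.
  have ph1 : ((pos u).-1 < height c)%N by lia.
  have [y1 _] := toggle_second ph0; have [_ y2] := toggle_second ph1.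
  have ph2 : ((pos u).-1.+1 < height c)%N by rewrite prednK //; case/andP: ph.
  rewrite ph2 in y2.
  move=> _; case: odd y1 y2 => y1 y2; first exact: (north c).
  by case: d y1 y2 => y1 y2; [exact: (north c)|exact: (south c)].
move=> /activeP[v [uv xuv]]; apply: (active_arc uv).
by have [cE _ _] := pick_adjacent uv; rewrite toggle_other.
Qed.

(** Each enclosed gap is crossed exactly twice by [y] and at least twice by [x]. Aisle [a] drops
    from two depths to one. Aisle [c] goes from one depth to less than two in the odd case, and
    otherwise from a positive cost to one depth. *)
Lemma toggle_cost : ~ empty_aisle x c -> cost y < cost x.
Proof.
move=> ne; rewrite !costE; apply: ltr_leD; last first.
  apply: ler_sum => j _; rewrite ler_wpM2l ?gap_length_ge0 // ler_nat.
  have jm := ltn_ord j; have jm' := ltnW jm.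
  have [inj|outj] := boolP (minn a c <= j < maxn a c)%N; last first.
    rewrite /gap_multiplicity /multiplicity !toggle_outside // /bottom !col_ladder //;
      by move: outj; lia.
  apply: (@leq_trans 2).
    rewrite /gap_multiplicity /multiplicity; have [-> -> -> ->] := toggle_inside jm inj.
    by case: (_ (+) _).
  have [q qh mq] : exists2 q, (q < height c)%N &
      (0 < multiplicity x (ladder c q) (ladder c q.+1))%N.
    have [/existsP[q mq]|/existsPn z] := boolP [exists q : 'I_(height c),
      (0 < multiplicity x (ladder c q) (ladder c q.+1))%N]; first by exists q.
    by case: ne => q qh; have := z (Ordinal qh); rewrite lt0n negbK => /eqP.
  (* Together with [ladder a 0] this gives an active location to the right of every enclosed gap,
     whichever of the two aisles is on the right. *)
  have [u cu xu] : exists2 u, col u = c & active x u.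
    have cq := adjacent_aisle cm qh; move: mq; rewrite /multiplicity.
    case xd : (x _ _); first by exists (ladder c q); rewrite ?col_ladder ?(active_arc cq).
    case xd' : (x _ _) => // _; exists (ladder c q.+1); rewrite ?col_ladder //.
    by apply: active_arc xd'; rewrite adjacentC.
  have [ja|ja] := ltnP j a.
    apply: (gap_multiplicity_ge2 tx jm _ active_first (flow0 inj)).
    by rewrite col_ladder.
  apply: (gap_multiplicity_ge2 tx jm _ xu (flow0 inj)); rewrite cu; lia.
rewrite (bigD1 (Ordinal (am : (a < m.+1)%N))) //=.
rewrite [ltRHS](bigD1 (Ordinal (am : (a < m.+1)%N))) //=.
have ca : Ordinal (cm : (c < m.+1)%N) != Ordinal (am : (a < m.+1)%N).
  by apply/eqP => -[e]; move: ac; rewrite e eqxx.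
rewrite (bigD1 (Ordinal (cm : (c < m.+1)%N))) //=.
rewrite [X in _ < _ + X](bigD1 (Ordinal (cm : (c < m.+1)%N))) //= !addrA.
apply: ltr_leD; last first.
  apply: ler_sum => i /andP[ia ic]; rewrite le_eqVlt; apply/orP; left; apply/eqP.
  apply: eq_bigr => p _; have im := leq_ord i.
  by rewrite /multiplicity !toggle_other ?col_ladder.
have -> : aisle_cost y a = depth * 1%:R.
  apply: aisle_cost_const => p ph; rewrite /multiplicity.
  by have [-> ->] := toggle_first ph; case: d.
have -> : aisle_cost x a = depth * 2%:R.
  apply: aisle_cost_const => p ph; rewrite /multiplicity.
  by have [-> ->] := dx ph.
have [oddT|oddF] := boolP odd.
  have -> : aisle_cost x c = depth * 1%:R.
    apply: aisle_cost_const => p ph; have := net_aisle bal cm ph.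
    rewrite flow_c oddT /net /multiplicity.
    by case: (x _ _) (x _ _); case; case: d.
  rewrite addrC ltrD2r; apply: (@aisle_cost_lt _ _ _ (height c).-1) => //.
    by move=> p _; apply: multiplicity_le2.
  have h : ((height c).-1 < height c)%N by [].
  rewrite /multiplicity; have [-> ->] := toggle_second h.
  by rewrite oddT prednK // ltnn.
have -> : aisle_cost y c = depth * 1%:R.
  apply: aisle_cost_const => p ph; rewrite /multiplicity.
  by have [-> ->] := toggle_second ph; rewrite (negbTE oddF); case: d.
have [/existsP[q mq]|/existsPn z] := boolP [exists q : 'I_(height c),
    (0 < multiplicity x (ladder c q) (ladder c q.+1))%N].
  by have := aisle_cost_gt0 (ltn_ord q) mq; lra.
by case: ne => q qh; have := z (Ordinal qh); rewrite lt0n negbK => /eqP.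
Qed.

End Toggle.

(** * Every doubled aisle can be improved *)

Lemma improve_toggle x a c : tour x -> (a <= m)%N -> (c <= m)%N -> a != c ->
  doubled x a -> ~ empty_aisle x c ->
  (forall j, (minn a c <= j < maxn a c)%N ->
     net x (ladder j 0) (ladder j.+1 0) = 0) -> improvable x.
Proof.
move=> tx am cm ac dx ne flow0; have bal := tour_balanced tx.
(* A nonzero flow in [c] dictates the orientation of the circulation; when it vanishes, either
   orientation works. *)
have [odd [d flow_c]] : exists odd d, aisle_flow x c = if odd then sgn d else 0.
  rewrite /aisle_flow /net; case: (x _ _); case: (x _ _).
  - by exists false, true.
  - by exists true, true.
  - by exists true, false.
  - by exists false, true.
exists (toggle x a c odd d); split.
- exact: toggle_tour.
- by move=> w; apply: toggle_active.
- exact: toggle_cost.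
Qed.

Lemma doubled_improvable x a : tour x -> (a <= m)%N -> doubled x a ->
  (1 < height a)%N -> improvable x.
Proof.
move=> tx am dx h1; have bal := tour_balanced tx.
(* By [net_top] this is the negated net flow of the northern gap [j]. For the last aisle it is the
   total flow, which vanishes. *)
pose flow j := \sum_(0 <= i < j.+1) aisle_flow x i.
have [flow_a|flow_a] := eqVneq (flow a) 0; last first.
  have [ama|] := ltnP a m.
    apply: (improve_open tx ama dx h1); by rewrite net_top // oppr_eq0.
  move=> ma; have e : a = m by lia.
  by move: flow_a; rewrite /flow e sum_aisle_flow ?eqxx.
pose used (c : 'I_m.+1) := (c != a :> nat) &&
  [exists q : 'I_(height c), multiplicity x (ladder c q) (ladder c q.+1) != 0%N].
have unused c : (c <= m)%N -> c != a -> ~~ used (inord c) -> empty_aisle x c.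
  move=> cm ca; rewrite /used inordK // ca /= => /existsPn z q qh.
  by have := z (Ordinal qh); rewrite negbK => /eqP.
have [/existsP[c0 u0]|/existsPn u0] := boolP [exists c, used c]; last first.
  by apply: (improve_drop tx am dx h1) => c cm ca; apply: unused.
(* The distance between the indices, as one of the truncated differences is zero. A nearest used
   aisle is taken, so the aisles strictly between are empty and the partial sums [flow] stay zero on
   all enclosed gaps. *)
pose far (c : 'I_m.+1) := ((c - a) + (a - c))%N.
case: (@arg_minnP _ c0 used far u0) => c /andP[ca /existsP[q mq]] cmin.
have cm := leq_ord c.
apply: (improve_toggle tx am cm _ dx) => [||j inj].
- by rewrite eq_sym.
- by move=> /(_ _ (ltn_ord q)) e; rewrite e eqxx in mq.
have jm : (j < m)%N by lia.
have between i : (minn a c < i < maxn a c)%N -> aisle_flow x i = 0.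
  move=> iin; apply/aisle_flow_empty/unused; [lia|lia|].
  apply/negP => /cmin; rewrite /far inordK; lia.
rewrite net_top //; apply/eqP; rewrite oppr_eq0; apply/eqP.
have [ja|ja] := ltnP j a; last first.
  rewrite (big_cat_nat (n := a.+1)) //= -/(flow a) flow_a add0r big_nat big1 // => i ii.
  apply: between; lia.
move: flow_a; rewrite /flow (big_cat_nat (n := j.+1)) ?ltnS 1?ltnW //=.
rewrite [X in _ + X = 0 -> _]big_nat [X in _ + X = 0 -> _]big1 ?addr0 // => i ii.
have [->|ia] := eqVneq i a; first exact: aisle_flow_doubled.
by apply: between; lia.
Qed.

(** * Straight paths and feasible solutions *)

Lemma ladder_pickE c p : (0 < p < height c)%N ->
  exists w : picking W, ladder c p = inr w.
Proof. by move=> /ladder_pick[q [_ ->]]; eexists. Qed.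

Lemma northE (w : picking W) : north w = ladder (col (inr w)) (pos (inr w)).-1.
Proof. exact: ladder_val. Qed.

Lemma southE (w : picking W) : south w = ladder (col (inr w)) (pos (inr w)).+1.
Proof. exact: ladder_val. Qed.

Lemma south_inr (v w : picking W) : south v = inr w ->
  col (inr w) = col (inr v) /\ pos (inr w) = (pos (inr v)).+1.
Proof.
rewrite southE => <-; have /andP[_ vh] := pos_pick v.
by rewrite col_ladder ?col_le // pos_ladder.
Qed.

Lemma north_inr (v w : picking W) : north v = inr w ->
  col (inr w) = col (inr v) /\ pos (inr w) = (pos (inr v)).-1.
Proof.
rewrite northE => <-; have /andP[_ vh] := pos_pick v.
by rewrite col_ladder ?col_le // pos_ladder //; lia.
Qed.

(** With [straight_south], the largest values of [alpha] and [beta] that the subaisle constraints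
    allow: they satisfy these constraints and bound any other solution. *)
Definition straight_north x (w : picking W) : bool :=
  [forall p : 'I_(pos (inr w)),
     x (ladder (col (inr w)) p) (ladder (col (inr w)) p.+1)].

Definition straight_south x (w : picking W) : bool :=
  [forall p : 'I_(height (col (inr w))), (pos (inr w) <= p)%N ==>
     x (ladder (col (inr w)) p.+1) (ladder (col (inr w)) p)].

Lemma straight_northP x w : reflect (forall p, (p < pos (inr w))%N ->
  x (ladder (col (inr w)) p) (ladder (col (inr w)) p.+1)) (straight_north x w).
Proof.
apply: (iffP forallP) => [xp p pw|xp p]; last exact: xp.
exact: (xp (Ordinal pw)).
Qed.

Lemma straight_southP x w : reflect (forall p, (pos (inr w) <= p < height (col (inr w)))%N ->
  x (ladder (col (inr w)) p.+1) (ladder (col (inr w)) p)) (straight_south x w).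
Proof.
apply: (iffP forallP) => [xp p /andP[pw ph]|xp p].
  exact: (implyP (xp (Ordinal ph))).
by apply/implyP => pw; apply: xp; rewrite pw ltn_ord.
Qed.

(** The edge north of [w] is used southward and the edge south of it northward. Their equal net
    flows are thus nonnegative and nonpositive, hence zero, and each edge used one way is used both
    ways. *)
Lemma straight_doubled x w : balanced x -> straight_north x w -> straight_south x w ->
  doubled x (col (inr w)).
Proof.
move=> bal /straight_northP xn /straight_southP xs.
have cm : (col (inr w) <= m)%N := col_le _.
have /andP[w0 wh] := pos_pick w.
have flow0 : aisle_flow x (col (inr w)) = 0.
  have ph : ((pos (inr w)).-1 < height (col (inr w)))%N by lia.
  have := net_aisle bal cm ph; have := net_aisle bal cm wh.
  have wph : (pos (inr w) <= pos (inr w) < height (col (inr w)))%N by rewrite leqnn.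
  have d1 : x (ladder (col (inr w)) (pos (inr w)).-1)
      (ladder (col (inr w)) (pos (inr w)).-1.+1) by apply: xn; lia.
  rewrite /net (xs _ wph) d1.
  by case: (x _ _) => <-; case: (x _ _).
move=> p ph; have := net_eq0 (etrans (net_aisle bal cm ph) flow0).
have [/xn ->|pw] := ltnP p (pos (inr w)); first by move=> <-.
by rewrite (xs p) ?pw ?ph // => ->.
Qed.

Lemma active_straight x w : tour x -> active x (inr w) ->
  straight_north x w || straight_south x w.
Proof.
move=> tx xw; apply: contraT; rewrite negb_or => /andP[].
rewrite negb_forall => /existsP[i ni]; rewrite negb_forall => /existsP[k].
rewrite negb_imply => /andP[wk nk].
have cm : (col (inr w) <= m)%N := col_le _; have kh := ltn_ord k; have iw := ltn_ord i.
(* The segment around [w] between a missing southward arc at [i] and a missing northward arc at [k].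
   The tour leaves it, so by balance enters it, but the only arcs that could enter are these two. *)
pose S : {set location W} := [set u | (col u == col (inr w)) && (i < pos u <= k)%N].
have : (0 < \sum_(e in arcs_in S) x e.1 e.2)%N.
  rewrite -(balanced_cut S (tour_balanced tx)); apply/sum_arcs_gt0.
  apply: (tour_connected tx _ _ xw); last by rewrite inE eqxx iw wk.
  have p0 : pos (origin W) = 0%N by rewrite /pos.
  by rewrite inE p0 ltn0 andbF.
move/sum_arcs_gt0 => [u [v []]]; rewrite !inE /= => /and3P[uv uS /andP[/eqP vc vik] xuv].
have [|w' vw'] := @ladder_pickE (col v) (pos v); first by rewrite vc; lia.
rewrite ladderK in vw'; rewrite vw' adjacentC in uv.
have [cE _ pE] := pick_adjacent uv; rewrite -vw' in cE pE.
rewrite cE vc eqxx /= in uS.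
have : x (ladder (col u) (pos u)) (ladder (col v) (pos v)) by rewrite !ladderK.
rewrite cE vc; case: pE => pE.
  have [pv pu] : pos v = k /\ pos u = k.+1 by lia.
  by rewrite pv pu (negbTE nk).
have [pv pu] : pos v = i.+1 /\ pos u = i by lia.
by rewrite pv pu (negbTE ni).
Qed.

(** * Passage between tours and solutions of the integer program *)

Section Routing.
Variables (O : finType) (L : O -> {set picking W}) (b : O -> R) (B : R) (T : nat).

Lemma tour_feasible (X : 'I_T -> location W -> location W -> bool)
    (Z : O -> 'I_T -> bool) :
  (forall t, tour (X t)) ->
  (forall t o w, w \in L o -> Z o t -> active (X t) (inr w)) ->
  (forall o, (\sum_(t < T) Z o t = 1)%N) ->
  (forall t, \sum_(o : O) b o * (Z o t)%:R <= B) ->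
  basic_feasible L b B X (fun t u => active (X t) u) Z.
Proof.
move=> tX aX once cap.
have out1 t u : active (X t) u ->
    (1 <= \sum_(e in arcs_out [set u]) X t e.1 e.2)%N.
  case/activeP=> v [uv xuv]; apply/sum_arcs_gt0; exists u, v; split=> //.
  rewrite !inE /= uv eqxx /=; apply/eqP => e; move: uv.
  by rewrite e (negbTE (adjacent_irrefl u)).
split=> //.
- by move=> t; apply/out1/tour_origin.
- by move=> t o u uo; case z : (Z o t) => //; apply/out1/(aX t o).
- move=> t u v _; rewrite !inE /= => /and3P[uv _ _].
  by case xuv : (X t u v); rewrite // (active_arc uv xuv).
- move=> t S u Ss _ uS; case xu : (active _ _) => //; apply/sum_arcs_gt0.
  apply: (tour_connected (tX t) _ uS xu); apply/negP => /(subsetP Ss).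
  by rewrite !inE eqxx.
- by move=> t; apply: tour_balanced.
Qed.

Variables (X : 'I_T -> location W -> location W -> bool) (Z : O -> 'I_T -> bool).

Lemma feasible_tour Y t : basic_feasible L b B X Y Z -> tour (X t).
Proof.
move=> fXYZ; split; first exact: conservation fXYZ t.
  (* The connectivity constraints concern sets with at least two elements. Either the arc out of [u]
     already leaves [S], or its head is a second element. *)
  move=> S u sS uS /activeP[v [uv xuv]]; have [vS|vS] := boolP (v \in S); last first.
    by exists u, v; rewrite inE /= uv uS vS.
  have vu : v != u by apply/eqP => e; move: uv; rewrite e (negbTE (adjacent_irrefl u)).
  have us : u != origin W by apply: contraNneq sS => <-.
  have yu : Y t u.
    have := mark_visited fXYZ t us (v := v); rewrite !inE /= uv eqxx vu xuv.
    by move=> /(_ isT); case: (Y t u).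
  apply/sum_arcs_gt0; apply: leq_trans (connectivity fXYZ t _ _ uS).
  - by rewrite yu.
  - by apply/subsetP => z zS; rewrite !inE; apply: contraNneq sS => <-.
  - by rewrite (cardsD1 u) uS ltnS card_gt0; apply/set0Pn; exists v; rewrite !inE vu.
have /sum_arcs_gt0[u [v []]] := leave_origin fXYZ t.
rewrite !inE /= => /and3P[uv /eqP us _] xuv; rewrite -us.
exact: active_arc xuv.
Qed.

Lemma feasible_visit Y t o w : basic_feasible L b B X Y Z -> w \in L o -> Z o t ->
  active (X t) (inr w).
Proof.
move=> fXYZ wo zot; have := visit_orders fXYZ t wo.
rewrite zot => /sum_arcs_gt0[u [v []]]; rewrite !inE /= => /and3P[uv /eqP uw _] xuv.
by rewrite -uw; apply: active_arc xuv.
Qed.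

Lemma straight_constraints Y : basic_feasible L b B X Y Z ->
  subaisle_constraints L X Z (fun t => straight_north (X t)) (fun t => straight_south (X t)).
Proof.
move=> fXYZ; split.
- move=> t v w /south_inr[cE pE]; case: straight_northP => // wn.
  case: straight_northP => //; case=> p pv; rewrite -cE; apply: wn; lia.
- move=> t v; case: straight_northP => // vn; have /andP[v0 _] := pos_pick v.
  by have := vn (pos (inr v)).-1; rewrite northE prednK // ladderK => ->.
- move=> t v w /north_inr[cE pE]; case: straight_southP => // ws.
  by case: straight_southP => //; case=> p pv; rewrite -cE; apply: ws; rewrite cE; lia.
- move=> t v; case: straight_southP => // vs; have /andP[_ vh] := pos_pick v.
  by have := vs (pos (inr v)); rewrite southE ladderK leqnn vh => ->.
- move=> t o v vo; case zot : (Z o t) => //.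
  have := active_straight (feasible_tour t fXYZ) (feasible_visit fXYZ vo zot).
  by case: straight_north; case: straight_south.
Qed.

(** Induction on the distance to the end of the aisle: the constraints supply the arc into [w] and
    pass the variable on to the neighbour nearer that end. *)
Lemma constraints_straight alpha beta t w : subaisle_constraints L X Z alpha beta ->
  (alpha t w -> straight_north (X t) w) /\ (beta t w -> straight_south (X t) w).
Proof.
move=> c; split.
  have [n] := ubnP (pos (inr w)); elim: n w => // n IH w wn aw.
  apply/straight_northP => p; have /andP[w0 wh] := pos_pick w.
  have := alpha_arc c t w; rewrite aw northE; case xw : (X _ _ _) => // _.
  rewrite -(prednK w0) ltnS leq_eqVlt => /orP[/eqP->|pw].
    by rewrite prednK // ladderK.
  have [|v vE] := @ladder_pickE (col (inr w)) (pos (inr w)).-1; first by lia.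
  have [cE pE] := north_inr (etrans (northE w) vE).
  have sv : south v = inr w by rewrite southE cE pE prednK // ladderK.
  have /straight_northP : straight_north (X t) v.
    apply: IH; first by rewrite pE; lia.
    by have := alpha_north c t sv; rewrite aw; case: (alpha t v).
  by rewrite cE pE; apply.
have [n] := ubnP (height (col (inr w)) - pos (inr w)); elim: n w => // n IH w wn bw.
apply/straight_southP => p /andP[wp ph]; have /andP[w0 wh] := pos_pick w.
have := beta_arc c t w; rewrite bw southE; case xw : (X _ _ _) => // _.
move: wp; rewrite leq_eqVlt => /orP[/eqP<-|pw]; first by rewrite ladderK.
have [|v vE] := @ladder_pickE (col (inr w)) (pos (inr w)).+1; first by lia.
have [cE pE] := south_inr (etrans (southE w) vE).
have nv : north v = inr w by rewrite northE cE pE /= ladderK.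
have /straight_southP : straight_south (X t) v.
  apply: IH; first by rewrite cE pE; lia.
  by have := beta_south c t nv; rewrite bw; case: (beta t v).
by rewrite cE pE; apply; rewrite pw ph.
Qed.

Lemma improvable_feasible Y t : basic_feasible L b B X Y Z -> improvable (X t) ->
  exists X' Y', basic_feasible L b B X' Y' Z /\ total_distance X' < total_distance X.
Proof.
move=> fXYZ [x' [tx' ax' lt_x']].
(* Only picker [t] changes its route; [y] is reset to the active locations for all pickers, and the
   assignment is kept. *)
pose X' s := if s == t then x' else X s.
exists X', (fun s u => active (X' s) u); split.
  have [_ _ _ _ _ once cap] := fXYZ.
  apply: tour_feasible => //.
    by move=> s; rewrite /X'; case: eqP => // _; apply: feasible_tour fXYZ.
  move=> s o w wo zos; have := feasible_visit fXYZ wo zos.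
  by rewrite /X'; case: eqP => [->|//]; apply: ax'.
rewrite /total_distance (bigD1 t) //= [ltRHS](bigD1 t) //=.
apply: ltr_leD; first by rewrite /X' eqxx.
by apply: ler_sum => s st; rewrite /X' (negbTE st).
Qed.

Lemma straight_improvable Y t w : basic_feasible L b B X Y Z ->
  straight_north (X t) w -> straight_south (X t) w -> improvable (X t).
Proof.
move=> fXYZ wn ws; have tX := feasible_tour t fXYZ.
apply: (doubled_improvable tX (col_le (inr w))).
  exact: straight_doubled (tour_balanced tX) wn ws.
by have := pos_pick w; lia.
Qed.

End Routing.

End Ladder.

(** * Optimal solutions of the augmented and of the basic formulation *)

Theorem corollary5p2 (R : realFieldType) (m : nat) (W : warehouse R m 1)
    (O : finType) (L : O -> {set picking W}) (b : O -> R) (B : R) (T : nat)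
    (hT : bin_packing_number b B T) :
  (forall (x : 'I_T -> location W -> location W -> bool)
          (y : 'I_T -> location W -> bool) (z : O -> 'I_T -> bool)
          (alpha beta : 'I_T -> picking W -> bool),
     augmented_optimal L b B x y z alpha beta ->
     single_traversing L alpha beta)
  /\
  (forall (x : 'I_T -> location W -> location W -> bool)
          (y : 'I_T -> location W -> bool) (z : O -> 'I_T -> bool),
     basic_optimal L b B x y z ->
     exists alpha beta : 'I_T -> picking W -> bool,
       augmented_feasible L b B x y z alpha beta /\
       single_traversing L alpha beta).
Proof.
split=> [x y z alpha beta [[fxyz cxz] opt]|x y z [fxyz opt]].
  move=> t o v _; case av : (alpha t v); case bv : (beta t v) => //.
  have [/(_ av) vn /(_ bv) vs] := constraints_straight t v cxz.
  have [x' [y' [fx' lt_x']]] :=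
    improvable_feasible fxyz (straight_improvable fxyz vn vs).
  (* The shorter basic solution becomes a competitor in the augmented formulation once its straight
     paths are taken for [alpha] and [beta]. *)
  have := opt _ _ _ _ _ (conj fx' (straight_constraints fx')).
  by rewrite leNgt lt_x'.
(* The witnesses are the straight paths of the optimal solution itself. *)
do 2!eexists; split; first exact: conj fxyz (straight_constraints fxyz).
move=> t o v _ /=; case vn : (straight_north _ _); case vs : (straight_south _ _) => //.
have [x' [y' [fx' lt_x']]] :=
  improvable_feasible fxyz (straight_improvable fxyz vn vs).
by have := opt _ _ _ fx'; rewrite leNgt lt_x'.
Qed.
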